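(* Let $n\ge 1$ and $m\ge 0$ be integers and let $S_{0,n,m}$ be the extended star graph with $n$ paths of length $2$ and $m$ paths of length $3$. Then $$\mathcal{M}(S_{0,n,m})\simeq \bigvee^{n-1}\mathbb{S}^{2m+n}.$$
   Context: The extended star graph $S_{a,b,c}$ is the graph obtained from $a$ paths of length $1$, $b$ paths of length $2$ and $c$ paths of length $3$ (length is the number of edges) by identifying one endpoint of each path with a fixed common vertex, called the center. $\bigvee^{r}\mathbb{S}^d$ is the wedge of $r$ copies of the $d$-sphere, a point when $r=0$. For a finite simplicial complex $K$, a discrete vector field on $K$ is a set $V$ of pairs $(\sigma^{(p)},\tau^{(p+1)})$ of simplices of $K$ with $\sigma$ a codimension-one face of $\tau$ (superscripts denote dimension), such that each simplex of $K$ is in at most one pair. A $V$-path is a sequence $\alpha_0^{(p)},\beta_0^{(p+1)},\alpha_1^{(p)},\beta_1^{(p+1)},\ldots,\beta_{k-1}^{(p+1)},\alpha_k^{(p)}$ of simplices with $(\alpha_i,\beta_i)\in V$ and $\beta_i>\alpha_{i+1}\neq\alpha_i$ for $0\le i\le k-1$; it is non-trivial if $k\neq 0$ and closed if $\alpha_k=\alpha_0$. A gradient vector field is a discrete vector field with no non-trivial closed $V$-paths; it is primitive if it consists of a single pair. The Morse complex $\mathcal{M}(K)$ is the simplicial complex whose vertices are the primitive gradient vector fields on $K$ and whose $n$-simplices are the gradient vector fields on $K$ with $n+1$ pairs, with face relation given by inclusion. *)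

(* Defs.v *)
From HB Require Import structures.
From mathcomp Require Import all_boot all_order all_algebra.
From mathcomp Require Import all_classical all_reals all_analysis.
From mathcomp Require Import homotopy.
Import Order.TTheory GRing.Theory Num.Theory.
Import numFieldNormedType.Exports.

Set Implicit Arguments.
Unset Strict Implicit.
Unset Printing Implicit Defensive.

Local Open Scope classical_set_scope.
Local Open Scope ring_scope.

(* Finite abstract simplicial complexes, without the empty simplex.  An element
   t of the ambient type T is a vertex of K iff [set t] \in K; other elements
   of T play no role. *)
Record scomplex (T : finType) := SComplex {
  simplices :> {set {set T}};
  simplices_neq0 : forall s, s \in simplices -> s != finset.set0;
  simplices_sub : forall s t : {set T},
    s \in simplices -> t != finset.set0 -> t \subset s -> t \in simplices
}.

Section Morse.
Context {T : finType}.
Implicit Types (K : scomplex T) (V W : {set {set T} * {set T}}).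

(* A p-simplex has p.+1 elements. *)
Definition discrete_vector_field K V : Prop :=
  (forall st, st \in V ->
     [/\ st.1 \in simplices K, st.2 \in simplices K,
         st.1 \subset st.2 & #|st.2| = #|st.1|.+1]) /\
  (forall s, s \in simplices K ->
     (#|[set st in V | (s == st.1) || (s == st.2)]%SET| <= 1)%N).

(* The V-path a 0, b 0, a 1, ..., b k.-1, a k of simplices of dimensions
   p and p.+1; the values of a beyond k and of b beyond k.-1 are irrelevant. *)
Definition V_path K V (p k : nat) (a b : nat -> {set T}) : Prop :=
  (forall i, (i <= k)%N -> a i \in simplices K /\ #|a i| = p.+1) /\
  (forall i, (i < k)%N ->
     [/\ b i \in simplices K, #|b i| = p.+2, (a i, b i) \in V,
         a i.+1 \subset b i & a i.+1 != a i]).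

Definition gradient_vector_field K V : Prop :=
  discrete_vector_field K V /\
  ~ (exists p k a b, [/\ V_path K V p k a b, k != 0%N & a k = a 0%N]).

(* A primitive gradient vector field {(s, t)} is represented by its only pair
   (s, t), so a simplex of the Morse complex, i.e. a set of vertices, is
   a non-empty gradient vector field. *)
Definition morse_simplices K : {set {set {set T} * {set T}}} :=
  [set V | (V != finset.set0) && `[< gradient_vector_field K V >]]%SET.

Lemma gradient_vector_field_sub K V W :
  gradient_vector_field K V -> W \subset V -> gradient_vector_field K W.
Proof.
move=> [[faceV uniqV] acycV] /fintype.subsetP WV; split; first split.
- by move=> st /WV; exact: faceV.
- move=> s /uniqV; apply: leq_trans; apply/subset_leq_card/fintype.subsetP => st.
  by rewrite !finset.inE => /andP[/WV -> ->].
- move=> [p [k [a [b [[aK abW] k0 ak]]]]]; apply: acycV.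
  exists p, k, a, b; split => //; split=> // i /abW[bK cb abi ? ?].
  by split=> //; exact: WV.
Qed.

Lemma morse_simplices_neq0 K s : s \in morse_simplices K -> s != finset.set0.
Proof. by rewrite finset.inE => /andP[]. Qed.

Lemma morse_simplices_sub K (s t : {set {set T} * {set T}}) :
  s \in morse_simplices K -> t != finset.set0 -> t \subset s ->
  t \in morse_simplices K.
Proof.
rewrite !finset.inE => /andP[_ /asboolP gs] -> ts /=.
by apply/asboolP/(gradient_vector_field_sub gs).
Qed.

Definition morse_complex K : scomplex _ :=
  SComplex (@morse_simplices_neq0 K) (@morse_simplices_sub K).

End Morse.

Section GraphComplex.
Context {T : finType} (e : rel T).

Definition graph_simplices : {set {set T}} :=
  [set s | [exists x, s == finset.set1 x] ||
           [exists x, exists y, [&& x != y, e x y & s == [set x; y]%SET]]]%SET.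

Lemma graph_simplices_neq0 s : s \in graph_simplices -> s != finset.set0.
Proof.
rewrite finset.inE => /orP[/existsP[x /eqP->]|].
  by apply/set0Pn; exists x; rewrite !finset.inE.
move=> /existsP[x /existsP[y /and3P[_ _ /eqP->]]].
by apply/set0Pn; exists x; rewrite !finset.inE eqxx.
Qed.

Lemma graph_simplices_sub (s t : {set T}) :
  s \in graph_simplices -> t != finset.set0 -> t \subset s ->
  t \in graph_simplices.
Proof.
move=> sG /set0Pn[z zt] ts; have [->//|tNs] := eqVneq t s.
suff /eqP tz : t == finset.set1 z.
  by rewrite finset.inE; apply/orP; left; apply/existsP; exists z; rewrite tz.
have t1 : (#|s| <= 2)%N.
  move: sG; rewrite finset.inE => /orP[/existsP[x /eqP->]|].
    by rewrite finset.cards1.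
  move=> /existsP[x /existsP[y /and3P[_ _ /eqP->]]].
  by rewrite finset.cards2; case: (_ != _).
have pts : (#|t| < #|s|)%N by apply: proper_card; rewrite finset.properEneq tNs.
rewrite eq_sym eqEcard finset.sub1set zt finset.cards1 /=.
by rewrite -ltnS; exact: leq_trans pts t1.
Qed.

Definition graph_complex : scomplex T :=
  SComplex graph_simplices_neq0 graph_simplices_sub.

End GraphComplex.

Section ExtendedStar.
Variables a b c : nat.

Definition star_leg_length (i : 'I_a + 'I_b + 'I_c) : nat :=
  match i with inl (inl _) => 1 | inl (inr _) => 2 | inr _ => 3 end.

(* None is the center; Some (i, j) is the vertex of leg i at distance j.+1
   from the center. *)
Definition star_vertex : finType :=
  option {i : 'I_a + 'I_b + 'I_c & 'I_(star_leg_length i)}.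

Definition star_adj : rel star_vertex := fun x y =>
  match x, y with
  | None, None => false
  | None, Some v | Some v, None => tagged v == 0%N :> nat
  | Some u, Some v => (tag u == tag v) &&
      (((tagged u).+1 == tagged v :> nat) || ((tagged v).+1 == tagged u :> nat))
  end.

Definition extended_star : scomplex star_vertex := graph_complex star_adj.

End ExtendedStar.

Section Spaces.
Variable R : realType.

(* Barycentric coordinates; since T is finite, the topology induced by R^T is
   the usual one. *)
Definition realization (T : finType) (K : scomplex T) : topologicalType :=
  [set x : {ptws T -> R} | [/\ forall t, 0 <= x t, \sum_t x t = 1
     & [set t | x t != 0]%SET \in simplices K]].

(* The library norm on 'rV is the sup norm, hence the explicit sum of squares. *)
Definition sphere_set (d : nat) : set 'rV[R]_d.+1 :=
  [set x | \sum_i x ord0 i ^+ 2 = 1].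
Arguments sphere_set d : clear implicits.

Definition sphere (d : nat) : topologicalType := sphere_set d.

Lemma sphere_base_subproof d : sphere_set d (delta_mx ord0 ord0).
Proof.
rewrite /sphere_set /= (bigD1 ord0) //= big1 ?mxE ?eqxx ?expr1n ?addr0 //.
by move=> i /negbTE i0; rewrite mxE i0 andbF expr0n.
Qed.

Definition sphere_base d : sphere d :=
  exist (fun x => x \in sphere_set d) _ (mem_set (@sphere_base_subproof d)).

(* The wedge of an empty family in the library is the empty space, hence the
   separate case r = 0,
   where the value is the one-point space. *)
Definition wedge_spheres (r d : nat) : topologicalType :=
  if r is r'.+1 then @wedge 'I_r'.+1 (fun=> sphere d) (fun=> sphere_base d)
  else set_type [set sphere_base d].

Definition homotopic (X Y : topologicalType) (f g : X -> Y) : Prop :=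
  exists H : X * R -> Y,
    [/\ {within [set: X] `*` `[0, 1], continuous H},
        forall x, H (x, 0) = f x & forall x, H (x, 1) = g x].

Definition homotopy_equivalent (X Y : topologicalType) : Prop :=
  exists (f : X -> Y) (g : Y -> X),
    [/\ continuous f, continuous g,
        homotopic (g \o f) idfun & homotopic (f \o g) idfun].

End Spaces.

(* Main.v *)
Require Import Defs.
From mathcomp Require Import all_boot all_order all_algebra.
From mathcomp Require Import all_classical all_reals all_analysis.
From mathcomp Require Import homotopy ring lra zify.
Import Order.TTheory GRing.Theory Num.Theory.
Import numFieldNormedType.Exports.

Set Implicit Arguments.
Unset Strict Implicit.
Unset Printing Implicit Defensive.

Local Open Scope classical_set_scope.
Local Open Scope ring_scope.

(** The star is a tree, so the only possible obstruction to a set of pairs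
    (vertex, edge) being a gradient vector field is that two pairs share
    a vertex or an edge ([tree_gradientP]).  Reading such a pair as an arc
    leaving its vertex along its edge, the Morse complex is the independence
    complex of the conflict graph on arcs ([tree_morse]).  In a leg the arcs
    form a path [a_1, ..., a_2l] from the center outwards, consecutive arcs
    being in conflict, and the arcs [a_1] of different legs are in conflict
    with each other.

    If every neighbor of [u] is a neighbor of [v], with [u] and [v] not in
    conflict, then [v] may be deleted without changing the homotopy type:
    moving the weight of [v] to [u] is a straight-line deformation inside the
    complex.  In a leg of length 2 this deletes [a_2] in favor of [a_4]; in
    a leg of length 3 it deletes [a_4] in favor of [a_6] ([star_fold]) and then
    [a_1] in favor of [a_3] ([star_split]).  What is left is a conflicting
    pair of arcs for each leg of length 2, two such pairs for each leg of
    length 3, no conflict between different pairs, and the arcs [a_1] of the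
    [n] legs of length 2, pairwise in conflict.  So the complex has become
    the join of [2m + n] copies of two points, an octahedral sphere of
    dimension [2m + n - 1], with [n] isolated points.

    That join consists of [n] hemispheres of dimension [2m + n] glued along
    their common boundary.  Collapsing the first one to a point turns each of
    the other [n - 1] into a sphere ([join_wedge]).  The collapse, its
    homotopy inverse and the two homotopies all come from the one deformation
    [(drift, shrink)] of a sphere, written without normalizing vectors and
    normalized afterwards in the sum of absolute values on the join side and
    in the Euclidean norm on the wedge side.  Continuity into the wedge is
    checked on coordinates, the wedge being embedded in the product of its
    spheres ([wedge_coord_lift]).  For [n = 1] the join is a cone
    ([join_cone]). *)

(** * Continuity and homotopy *)

Section TopContinuity.
Variables (X Y Z : topologicalType).

Lemma cont_comp (f : X -> Y) (g : Y -> Z) : continuous f -> continuous g ->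
  continuous (fun x => g (f x)).
Proof. by move=> cf cg x; apply: continuous_comp; [exact: cf | exact: cg]. Qed.

Lemma cont_pair (f : Z -> X) (g : Z -> Y) : continuous f -> continuous g ->
  continuous (fun z => (f z, g z)).
Proof. by move=> cf cg z; apply: cvg_pair; [exact: cf | exact: cg]. Qed.

Lemma cont_fst : continuous (@fst X Y).
Proof. by move=> z; exact: cvg_fst. Qed.

Lemma cont_snd : continuous (@snd X Y).
Proof. by move=> z; exact: cvg_snd. Qed.

End TopContinuity.

Section RealContinuity.
Variables (R : realType) (X : topologicalType).
Implicit Types f g : X -> R.

Lemma contC (c : R) : continuous (fun _ : X => c).
Proof. by move=> x; exact: cvg_cst. Qed.

Lemma contD f g : continuous f -> continuous g -> continuous (fun x => f x + g x).
Proof. by move=> cf cg x; apply: cvgD; [exact: cf | exact: cg]. Qed.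

Lemma contN f : continuous f -> continuous (fun x => - f x).
Proof. by move=> cf x; apply: cvgN; exact: cf. Qed.

Lemma contM f g : continuous f -> continuous g -> continuous (fun x => f x * g x).
Proof. by move=> cf cg x; apply: cvgM; [exact: cf | exact: cg]. Qed.

Lemma contV f : (forall x, f x != 0) -> continuous f -> continuous (fun x => (f x)^-1).
Proof. by move=> f0 cf x; apply: cvgV => //; exact: cf. Qed.

Lemma contX f n : continuous f -> continuous (fun x => f x ^+ n).
Proof.
move=> cf; elim: n => [|n IH]; first exact: contC.
by under [fun x => _]funext do rewrite exprS; exact: contM.
Qed.

Lemma cont_norm f : continuous f -> continuous (fun x => `|f x|).
Proof. by move=> cf x; apply: cvg_norm; exact: cf. Qed.

Lemma cont_sqrt f : continuous f -> continuous (fun x => Num.sqrt (f x)).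
Proof. by move=> cf x; apply: continuous_comp; [exact: cf | exact: sqrt_continuous]. Qed.

Lemma cont_max f g : continuous f -> continuous g ->
  continuous (fun x => Num.max (f x) (g x)).
Proof.
move=> cf cg; under [fun x => _]funext do rewrite maxr_absE.
apply: contM; last exact: contC.
apply: contD; first exact: contD.
by apply: cont_norm; apply: contD => //; exact: contN.
Qed.

Lemma cont_min f g : continuous f -> continuous g ->
  continuous (fun x => Num.min (f x) (g x)).
Proof.
move=> cf cg; under [fun x => _]funext do rewrite minr_absE.
apply: contM; last exact: contC.
apply: contD; first exact: contD.
by apply: contN; apply: cont_norm; apply: contD => //; exact: contN.
Qed.

Lemma cont_sum (I : Type) (r : seq I) (P : pred I) (F : I -> X -> R) :
  (forall i, P i -> continuous (F i)) ->
  continuous (fun x => \sum_(i <- r | P i) F i x).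
Proof.
move=> cF; elim: r => [|i r IH].
  rewrite (_ : (fun x => _) = fun=> 0); first exact: contC.
  by apply/funext => x; rewrite big_nil.
rewrite (_ : (fun x => _) = fun x =>
  (if P i then F i x + \sum_(j <- r | P j) F j x else \sum_(j <- r | P j) F j x));
  last by apply/funext => x; rewrite big_cons.
by case Pi : (P i) => //; apply: contD => //; exact: cF.
Qed.

End RealContinuity.

Section Homotopy.
Variable R : realType.
Implicit Types X Y Z : topologicalType.

(** Composing with the retraction of the line onto the unit interval makes
    a homotopy continuous on the whole line, so that homotopies can be
    reparametrized and composed as total maps. *)
Definition clamp (t : R) : R := Num.max 0 (Num.min t 1).

Lemma clamp_continuous : continuous clamp.
Proof.
by apply: cont_max; [exact: contC | apply: cont_min; [move=> t | exact: contC]].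
Qed.

Lemma clamp_itv t : 0 <= clamp t <= 1.
Proof.
by rewrite /clamp le_max lexx /= ge_max ler01 ge_min lexx orbT.
Qed.

Lemma clamp_le0 t : t <= 0 -> clamp t = 0.
Proof. by move=> t0; rewrite /clamp min_l ?max_l //; lra. Qed.

Lemma clamp_ge1 t : 1 <= t -> clamp t = 1.
Proof. by move=> t0; rewrite /clamp min_r ?max_r //; lra. Qed.

Lemma clamp0 : clamp 0 = 0. Proof. by rewrite clamp_le0. Qed.
Lemma clamp1 : clamp 1 = 1. Proof. by rewrite clamp_ge1. Qed.

Lemma homotopic_total X Y (f g : X -> Y) (H : X * R -> Y) :
  continuous H -> (forall x, H (x, 0) = f x) -> (forall x, H (x, 1) = g x) ->
  homotopic R f g.
Proof. by move=> cH H0 H1; exists H; split=> //; exact: continuous_subspaceT. Qed.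

Lemma homotopicP X Y (f g : X -> Y) : homotopic R f g -> exists H : X * R -> Y,
  [/\ continuous H, forall x t, t <= 0 -> H (x, t) = f x &
      forall x t, 1 <= t -> H (x, t) = g x].
Proof.
move=> [H [cH H0 H1]]; exists (fun z => H (z.1, clamp z.2)); split.
- move=> z; pose A : set (X * R) := [set: X] `*` `[0, 1]%classic.
  have cl (z' : X * R) : A (z'.1, clamp z'.2).
    by split=> //=; rewrite in_itv /=; exact: clamp_itv.
  have cc : continuous (fun z' : X * R => (z'.1, clamp z'.2)).
    apply: cont_pair; first exact: cont_fst.
    exact: cont_comp (@cont_snd _ _) clamp_continuous.
  move/subspace_continuousP : cH => /(_ _ (cl z)) cH.
  move=> U /cH; rewrite /= !nbhs_simpl /= => /cc /=; rewrite nbhs_simpl /=.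
  by apply: filterS => z' /(_ (cl z')).
- by move=> x t t0; rewrite /= clamp_le0.
- by move=> x t t1; rewrite /= clamp_ge1.
Qed.

(** The first homotopy runs on [0, 1/2] and the second one on [1/2, 1]; both
    are constant outside the unit interval, so they agree at 1/2. *)
Lemma homotopic_trans X Y (f g h : X -> Y) :
  homotopic R f g -> homotopic R g h -> homotopic R f h.
Proof.
move=> /homotopicP[F [cF F0 F1]] /homotopicP[G [cG G0 G1]].
pose A := [set z : X * R | z.2 <= 2^-1]; pose B := [set z : X * R | 2^-1 <= z.2].
pose H z := if z.2 <= 2^-1 then F (z.1, 2 * z.2) else G (z.1, 2 * z.2 - 1).
have affine (a b : R) : continuous (fun z : X * R => (z.1, a * z.2 + b)).
  apply: cont_pair; first exact: cont_fst.
  by apply: contD; [apply: contM; [exact: contC | exact: cont_snd] | exact: contC].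
have clA : closed A.
  by rewrite -[A]/(snd @^-1` [set t : R | t <= 2^-1]); apply: closed_comp => [z _|];
    [exact: cvg_snd | exact: closed_le].
have clB : closed B.
  by rewrite -[B]/(snd @^-1` [set t : R | 2^-1 <= t]); apply: closed_comp => [z _|];
    [exact: cvg_snd | exact: closed_ge].
apply: (@homotopic_total _ _ _ _ H).
- apply/continuous_subspace_setT.
  have -> : [set: X * R] = A `|` B.
    apply/seteqP; split=> // z _; rewrite /A /B /=.
    by case: (leP z.2 2^-1) => [|/ltW]; [left | right].
  apply: withinU_continuous => //.
  + apply: (@subspace_eq_continuous _ A _ (fun z => F (z.1, 2 * z.2 + 0)) H).
      by move=> z; rewrite inE /A /H /= addr0 => ->.
    by apply: continuous_subspaceT; apply: (cont_comp (affine 2 0) cF).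
  + apply: (@subspace_eq_continuous _ B _ (fun z => G (z.1, 2 * z.2 + -1)) H).
      move=> z; rewrite inE /B /H /= => zB; case: ifPn => // zA.
      have -> : z.2 = 2^-1 by apply/eqP; rewrite eq_le zA zB.
      by rewrite mulfV // subrr F1 // G0.
    by apply: continuous_subspaceT; apply: (cont_comp (affine 2 (-1)) cG).
- by move=> x; rewrite /H /= invr_ge0 ler0n mulr0 F0.
- move=> x; rewrite /H /= ifF; first by rewrite G1 //; lra.
  by apply/negbTE; rewrite -ltNge invf_lt1 // ltr1n.
Qed.

Lemma homotopic_comp X Y Z (W : topologicalType) (h : X -> Y) (f g : Y -> Z) (k : Z -> W) :
  continuous h -> continuous k -> homotopic R f g ->
  homotopic R (k \o f \o h) (k \o g \o h).
Proof.
move=> ch ck /homotopicP[H [cH H0 H1]].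
apply: (@homotopic_total _ _ _ _ (fun z => k (H (h z.1, z.2)))).
- apply: cont_comp ck; apply: cont_comp cH; apply: cont_pair; last exact: cont_snd.
  exact: cont_comp (@cont_fst _ _) ch.
- by move=> x; rewrite H0.
- by move=> x; rewrite H1.
Qed.

Lemma homotopy_equivalent_trans X Y Z :
  homotopy_equivalent R X Y -> homotopy_equivalent R Y Z ->
  homotopy_equivalent R X Z.
Proof.
move=> [f [g [cf cg gf fg]]] [f' [g' [cf' cg' gf' fg']]].
exists (f' \o f), (g \o g'); split.
- by move=> x; apply: continuous_comp; [exact: cf | exact: cf'].
- by move=> x; apply: continuous_comp; [exact: cg' | exact: cg].
- exact: homotopic_trans (homotopic_comp cf cg gf') gf.
- exact: homotopic_trans (homotopic_comp cg' cf' fg) fg'.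
Qed.

End Homotopy.

(** * Maps into realizations and contiguity *)

Section Realization.
Variables (R : realType) (T : finType) (K : scomplex T).

Definition bary (x : realization R K) : T -> R := set_val x.

Definition supp (u : T -> R) : {set T} := [set t | u t != 0]%SET.

Lemma bary_ge0 x t : 0 <= bary x t.
Proof. by have [] := set_mem (valP x). Qed.

Lemma bary_sum x : \sum_t bary x t = 1.
Proof. by have [] := set_mem (valP x). Qed.

Lemma bary_supp x : supp (bary x) \in simplices K.
Proof. by have [] := set_mem (valP x). Qed.

Lemma bary_inj : injective bary.
Proof. by move=> x y xy; apply: val_inj. Qed.

Lemma bary_continuous t : continuous (fun x => bary x t).
Proof.
apply: (@cont_comp _ _ _ (set_val : realization R K -> {ptws T -> R})
   (fun u : {ptws T -> R} => u t)).
  exact: initial_continuous.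
exact: (@proj_continuous _ (fun=> R) t).
Qed.

(** The realization has the initial topology for barycentric coordinates. *)
Lemma realization_continuous (Z : topologicalType) (f : Z -> realization R K) :
  (forall t, continuous (fun z => bary (f z) t)) -> continuous f.
Proof.
move=> cf; apply: continuous_comp_initial => z.
apply/cvg_sup => t; apply/cvg_image; last first.
  move=> U /(cf t z) nU; exists ((fun u : {ptws T -> R} => u t) @^-1` U) => //.
  by apply/seteqP; split=> [_ [u Uu <-]//|a Ua]; exists (fun=> a).
by apply/seteqP; split=> // a _; exists (fun=> a).
Qed.

(** A family of nonzero nonnegative weights supported on simplices descends to
    the realization after dividing by the total weight; this lets maps into
    [K] be written down without keeping the sum of coordinates equal to 1. *)
Lemma realization_lift (Z : topologicalType) (u : Z -> T -> R) :
  (forall t, continuous (u^~ t)) -> (forall z t, 0 <= u z t) ->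
  (forall z, supp (u z) \in simplices K) ->
  exists F : Z -> realization R K, continuous F /\
    forall z t, bary (F z) t = u z t / \sum_s u z s.
Proof.
move=> cu u0 uK.
have S0 z : \sum_s u z s != 0.
  have /set0Pn[t] := simplices_neq0 (uK z); rewrite finset.inE => ut.
  rewrite gt_eqF // (bigD1 t) //= ltr_pwDl ?sumr_ge0 //.
  by rewrite lt_def ut u0.
pose v z : {ptws T -> R} := fun t => u z t / \sum_s u z s.
have vK z : [/\ forall t, 0 <= v z t, \sum_t v z t = 1 &
    [set t | v z t != 0]%SET \in simplices K].
  split.
  - by move=> t; rewrite divr_ge0 // sumr_ge0.
  - by rewrite -mulr_suml divff.
  - suff -> : [set t | v z t != 0]%SET = supp (u z) by [].
    by apply/setP => t; rewrite !finset.inE mulf_eq0 invr_eq0 (negbTE (S0 z)) orbF.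
exists (fun z => exist _ (v z) (mem_set (vK z))); split; last by [].
apply: realization_continuous => t.
apply: contM; first exact: cu.
by apply: contV => //; apply: cont_sum => s _; exact: cu.
Qed.

(** The segment from [f x] to [g x] stays in the simplex spanned by their two
    supports. *)
Lemma straight_line_homotopic (X : topologicalType) (f g : X -> realization R K) :
  continuous f -> continuous g ->
  (forall x, supp (bary (f x)) :|: supp (bary (g x)) \in simplices K)%SET ->
  homotopic R f g.
Proof.
move=> cf cg fgK.
pose u (z : X * R) t :=
  (1 - clamp z.2) * bary (f z.1) t + clamp z.2 * bary (g z.1) t.
have c01 (z : X * R) : 0 <= clamp z.2 <= 1 := clamp_itv _.
have u0 z t : 0 <= u z t.
  have /andP[? ?] := c01 z.
  by rewrite addr_ge0 // mulr_ge0 ?bary_ge0 ?subr_ge0.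
have usum z : \sum_t u z t = 1.
  by rewrite big_split /= -!mulr_sumr !bary_sum !mulr1 subrK.
have [|//|z|F [cF FE]] := @realization_lift _ u.
- move=> t; have cc := cont_comp (@cont_snd X R) (@clamp_continuous R).
  apply: contD; apply: contM.
  + by apply: contD; [exact: contC | exact: contN].
  + by apply: cont_comp (@bary_continuous t); exact: cont_comp (@cont_fst X R) cf.
  + exact: cc.
  + by apply: cont_comp (@bary_continuous t); exact: cont_comp (@cont_fst X R) cg.
- apply: simplices_sub (fgK z.1) _ _.
    apply/negP => /eqP s0; have := usum z; rewrite big1 => [/eqP|t _].
      by rewrite eq_sym oner_eq0.
    apply/eqP/negPn/negP => ut.
    by have : t \in supp (u z); [rewrite finset.inE | rewrite s0 finset.inE].
  apply/fintype.subsetP => t; rewrite !finset.inE; apply: contraR.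
  by rewrite negb_or !negbK /u => /andP[/eqP-> /eqP->]; rewrite !mulr0 addr0.
apply: (homotopic_total cF) => x; apply/bary_inj/funext => t;
  by rewrite FE usum divr1 /u /= ?clamp0 ?clamp1 ?subrr ?subr0 ?mul0r ?mul1r ?addr0 ?add0r.
Qed.

End Realization.

Section Contiguity.
Variables (R : realType).

(** The weight of a vertex is transported to its image, the weights of
    vertices with the same image being added. *)
Lemma simplicial_map (T T' : finType) (K : scomplex T) (L : scomplex T')
    (phi : T -> T') :
  (forall s, s \in simplices K -> phi @: s \in simplices L)%SET ->
  exists F : realization R K -> realization R L, continuous F /\
    forall x, supp (bary (F x)) = (phi @: supp (bary x))%SET.
Proof.
move=> phiKL.
pose u (x : realization R K) t' := \sum_(t | phi t == t') bary x t.
have u0 x t' : 0 <= u x t' by apply: sumr_ge0 => t _; exact: bary_ge0.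
have su x : supp (u x) = (phi @: supp (bary x))%SET.
  apply/setP => t'; rewrite finset.inE; apply/idP/imsetP => [ut'|[t xt ->]].
    case: (boolP [exists t in supp (bary x), phi t == t']) => [/exists_inP|/exists_inPn nx].
      by case=> t xt /eqP <-; exists t.
    case/negP: ut'; apply/eqP/big1 => t /eqP tt'.
    apply/eqP/negPn/negP => xt; have /nx : t \in supp (bary x) by rewrite finset.inE.
    by rewrite tt' eqxx.
  rewrite finset.inE in xt.
  rewrite gt_eqF // /u (bigD1 t) //= ltr_pwDl //.
    by rewrite lt_def xt bary_ge0.
  by apply: sumr_ge0 => s _; exact: bary_ge0.
have [|//|x|F [cF FE]] := @realization_lift R _ L _ u.
- by move=> t'; apply: cont_sum => t _; exact: bary_continuous.
- by rewrite su; apply: phiKL; exact: bary_supp.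
exists F; split=> // x; rewrite -su; apply/setP => t'; rewrite !finset.inE FE.
suff -> : \sum_s u x s = 1 by rewrite divr1.
rewrite -(bary_sum x) (partition_big phi xpredT) //=.
Qed.

(** Two simplicial maps are contiguous when the images of every simplex span
    a common simplex; contiguous maps are then joined by straight lines.  So
    simplicial maps whose two composites are contiguous to the identities are
    mutually inverse up to homotopy.  Isomorphisms of complexes, and foldings
    of dominated vertices, are instances. *)
Lemma contiguity_equivalence (T T' : finType) (K : scomplex T) (L : scomplex T')
    (phi : T -> T') (psi : T' -> T) :
  (forall s, s \in simplices K -> phi @: s \in simplices L)%SET ->
  (forall s, s \in simplices L -> psi @: s \in simplices K)%SET ->
  (forall s, s \in simplices K -> psi @: (phi @: s) :|: s \in simplices K)%SET ->
  (forall s, s \in simplices L -> phi @: (psi @: s) :|: s \in simplices L)%SET ->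
  homotopy_equivalent R (realization R K) (realization R L).
Proof.
move=> phiKL psiLK KK LL.
have [F [cF sF]] := simplicial_map phiKL.
have [G [cG sG]] := simplicial_map psiLK.
exists F, G; split=> //; apply: straight_line_homotopic.
- exact: cont_comp cF cG.
- by move=> x.
- by move=> x; rewrite /= sG sF; apply: KK; exact: bary_supp.
- exact: cont_comp cG cF.
- by move=> x.
- by move=> x; rewrite /= sF sG; apply: LL; exact: bary_supp.
Qed.

End Contiguity.

(** * Independence complexes *)

Section Independence.
Variables (T : finType) (c : rel T).

Definition indep_simplices : {set {set T}} :=
  [set s : {set T} | (s != finset.set0) && [forall x in s, forall y in s, ~~ c x y]]%SET.

Lemma indepP (s : {set T}) : reflect
  (s != finset.set0 /\ forall x y, x \in s -> y \in s -> ~~ c x y)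
  (s \in indep_simplices).
Proof.
rewrite finset.inE; apply: (iffP andP) => -[s0 sc]; split=> //.
  by move=> x y xs ys; exact: (forall_inP (forall_inP sc x xs) y ys).
by apply/forall_inP => x xs; apply/forall_inP => y; exact: sc.
Qed.

Lemma indep_simplices_neq0 s : s \in indep_simplices -> s != finset.set0.
Proof. by move=> /indepP[]. Qed.

Lemma indep_simplices_sub (s t : {set T}) : s \in indep_simplices ->
  t != finset.set0 -> t \subset s -> t \in indep_simplices.
Proof.
move=> /indepP[_ sc] t0 /fintype.subsetP ts; apply/indepP; split=> // x y xt yt.
by apply: sc; exact: ts.
Qed.

(** The complex of independent sets of the graph [c]; a loop of [c] deletes
    its vertex, which allows passing to full subcomplexes without changing
    the type of vertices. *)
Definition indep_complex := SComplex indep_simplices_neq0 indep_simplices_sub.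

End Independence.

Section IndependenceEquivalence.
Variable R : realType.

(** For independence complexes contiguity is a condition on pairs of vertices. *)
Lemma indep_equivalence (T T' : finType) (c : rel T) (d : rel T')
    (phi : T -> T') (psi : T' -> T) :
  symmetric c -> symmetric d ->
  (forall x y, ~~ c x x -> ~~ c y y -> ~~ c x y -> ~~ d (phi x) (phi y)) ->
  (forall x y, ~~ d x x -> ~~ d y y -> ~~ d x y -> ~~ c (psi x) (psi y)) ->
  (forall x y, ~~ c x x -> ~~ c y y -> ~~ c x y -> ~~ c (psi (phi x)) y) ->
  (forall x y, ~~ d x x -> ~~ d y y -> ~~ d x y -> ~~ d (phi (psi x)) y) ->
  homotopy_equivalent R (realization R (indep_complex c))
                        (realization R (indep_complex d)).
Proof.
have img (U U' : finType) (a : rel U) (b : rel U') (f : U -> U') :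
    (forall x y, ~~ a x x -> ~~ a y y -> ~~ a x y -> ~~ b (f x) (f y)) ->
    (forall s, s \in simplices (indep_complex a) ->
      f @: s \in simplices (indep_complex b))%SET.
  move=> fab s /indepP[s0 sa]; apply/indepP; split.
    by case/set0Pn: s0 => x xs; apply/set0Pn; exists (f x); exact: imset_f.
  by move=> _ _ /imsetP[x xs ->] /imsetP[y ys ->]; apply: fab; exact: sa.
have cup (U U' : finType) (a : rel U) (b : rel U') (f : U -> U') (g : U' -> U) :
    symmetric a ->
    (forall x y, ~~ a x x -> ~~ a y y -> ~~ a x y -> ~~ b (f x) (f y)) ->
    (forall x y, ~~ b x x -> ~~ b y y -> ~~ b x y -> ~~ a (g x) (g y)) ->
    (forall x y, ~~ a x x -> ~~ a y y -> ~~ a x y -> ~~ a (g (f x)) y) ->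
    (forall s, s \in simplices (indep_complex a) ->
      g @: (f @: s) :|: s \in simplices (indep_complex a))%SET.
  move=> asym fab gba gfa s sa; have /indepP[s0 sI] := sa.
  have /indepP[_ gfs] := img _ _ _ _ _ gba _ (img _ _ _ _ _ fab _ sa).
  have cross x y : x \in (g @: (f @: s))%SET -> y \in s -> ~~ a x y.
    by move=> /imsetP[_ /imsetP[z zs ->] ->] ys; apply: gfa; exact: sI.
  apply/indepP; split.
    by case/set0Pn: s0 => x xs; apply/set0Pn; exists x; rewrite finset.inE xs orbT.
  move=> x y; rewrite !finset.in_setU => /orP[xs|xs] /orP[ys|ys].
  - exact: (gfs _ _ xs ys).
  - exact: (cross _ _ xs ys).
  - by rewrite asym; exact: (cross _ _ ys xs).
  - exact: (sI _ _ xs ys).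
move=> csym dsym cd dc cc dd.
apply: (contiguity_equivalence R (img _ _ _ _ _ cd) (img _ _ _ _ _ dc)).
- exact: (cup _ _ _ _ phi psi csym cd dc cc).
- exact: (cup _ _ _ _ psi phi dsym dc cd dd).
Qed.

End IndependenceEquivalence.

(** * Spheres and wedges in coordinates *)

Section Spheres.
Variables (R : realType) (J : finType).
Local Notation S := (sphere R #|J|).

(** The polar axis is the one through the base point; the equatorial axes are
    indexed by [J]. *)
Definition sph_pole (w : S) : R := set_val w ord0 ord0.
Definition sph_eq (w : S) (k : J) : R := set_val w ord0 (lift ord0 (enum_rank k)).

Lemma sum_sphere_coords (F : 'I_(#|J|.+1) -> R) :
  \sum_i F i = F ord0 + \sum_k F (lift ord0 (enum_rank k)).
Proof.
rewrite big_ord_recl; congr (_ + _).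
by rewrite (reindex (@enum_rank J)) //=; exists enum_val => x _; rewrite ?enum_valK ?enum_rankK.
Qed.

Lemma sph_norm w : sph_pole w ^+ 2 + \sum_k sph_eq w k ^+ 2 = 1.
Proof.
have := set_mem (valP w); rewrite /sphere_set /= => <-.
by rewrite sum_sphere_coords.
Qed.

Lemma sph_ext w w' : sph_pole w = sph_pole w' ->
  (forall k, sph_eq w k = sph_eq w' k) -> w = w'.
Proof.
move=> e0 ek; apply: val_inj; apply/rowP => i.
have [j ->|->] := unliftP ord0 i; last exact: e0.
by rewrite -[j]enum_valK; exact: ek.
Qed.

Lemma sph_base_pole : sph_pole (sphere_base R #|J|) = 1.
Proof. by rewrite /sph_pole /= mxE !eqxx. Qed.

Lemma sph_base_eq k : sph_eq (sphere_base R #|J|) k = 0.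
Proof. by rewrite /sph_eq /= mxE eq_sym (negbTE (neq_lift _ _)) andbF. Qed.

Lemma sphere_baseP w : sph_pole w = 1 -> w = sphere_base R #|J|.
Proof.
move=> w1; apply: sph_ext; rewrite ?sph_base_pole // => k.
have := sph_norm w; rewrite w1 expr1n -[RHS]addr0 => /addrI /eqP.
rewrite psumr_eq0 => [/allP /(_ k)|j _]; last exact: sqr_ge0.
by rewrite mem_index_enum sqrf_eq0 sph_base_eq => /(_ isT) /eqP.
Qed.

Lemma row_continuous (Z : topologicalType) d (f : Z -> 'rV[R]_d) :
  (forall i, continuous (fun z => f z ord0 i)) -> continuous f.
Proof.
move=> cf z U [P nP PU].
have : \forall x \near z, forall i, P ord0 i (f x ord0 i).
  by apply: filter_forall => i; exact: (cf i z).
by apply: filterS => x Px; apply: PU => i j; rewrite ord1.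
Qed.

Lemma sph_pole_continuous : continuous sph_pole.
Proof.
apply: (@cont_comp _ _ _ (set_val : S -> 'rV[R]_(#|J|.+1)) (fun M => M ord0 ord0)).
  exact: initial_continuous.
exact: coord_continuous.
Qed.

Lemma sph_eq_continuous k : continuous (fun w => sph_eq w k).
Proof.
apply: (@cont_comp _ _ _ (set_val : S -> 'rV[R]_(#|J|.+1))
  (fun M => M ord0 (lift ord0 (enum_rank k)))).
  exact: initial_continuous.
exact: coord_continuous.
Qed.

(** Maps to the sphere may be given by nonvanishing vectors, which are then
    divided by their norm; only the ray of the value is ever used, hence the
    unspecified factor [c]. *)
Lemma sphere_lift (Z : topologicalType) (s : Z -> R) (z : Z -> J -> R) :
  continuous s -> (forall k, continuous (z^~ k)) ->
  (forall x, s x != 0 \/ exists k, z x k != 0) ->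
  exists F : Z -> S, continuous F /\ forall x, exists2 c, 0 < c &
    sph_pole (F x) = c * s x /\ forall k, sph_eq (F x) k = c * z x k.
Proof.
move=> cs cz nz.
pose q x := s x ^+ 2 + \sum_k z x k ^+ 2.
have q0 x : 0 < q x.
  have z0 : 0 <= \sum_k z x k ^+ 2 by apply: sumr_ge0 => k _; exact: sqr_ge0.
  have [s0|[k k0]] := nz x.
    by rewrite ltr_pwDl // exprn_even_gt0.
  rewrite /q (bigD1 k) //= ltr_wpDl ?sqr_ge0 // ltr_pwDl ?exprn_even_gt0 //.
  by apply: sumr_ge0 => j _; exact: sqr_ge0.
pose c x := (Num.sqrt (q x))^-1.
have c0 x : 0 < c x by rewrite invr_gt0 sqrtr_gt0.
have cc : continuous c.
  apply: contV => [x|]; first by rewrite gt_eqF // sqrtr_gt0.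
  apply: cont_sqrt; apply: contD; first exact: contX.
  by apply: cont_sum => k _; exact: contX.
pose v x : 'rV[R]_(#|J|.+1) :=
  \row_i (c x * (if unlift ord0 i is Some k then z x (enum_val k) else s x)).
have v0 x : v x ord0 ord0 = c x * s x by rewrite mxE unlift_none.
have vk x k : v x ord0 (lift ord0 (enum_rank k)) = c x * z x k.
  by rewrite mxE liftK enum_rankK.
have vS x : @sphere_set R #|J| (v x).
  rewrite /sphere_set /= sum_sphere_coords v0.
  under eq_bigr do rewrite vk exprMn.
  rewrite exprMn -mulr_sumr -mulrDr -/(q x) /c exprVn sqr_sqrtr ?ltW //.
  by rewrite mulVf // gt_eqF.
exists (fun x => exist _ (v x) (mem_set (vS x))); split.
  apply: continuous_comp_initial; apply: row_continuous => i.
  under [fun x => _]funext do rewrite /= mxE.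
  by apply: contM => //; case: unliftP => [j _|_].
by move=> x; exists (c x) => //; split; [exact: v0 | exact: vk].
Qed.

Lemma closed_sphere_base : closed [set sphere_base R #|J|].
Proof.
rewrite (_ : [set _] = sph_pole @^-1` [set 1]).
  by apply: closed_comp => [w _|]; [exact: sph_pole_continuous | exact: closed_eq].
apply/seteqP; split=> [_ ->|w]; first exact: sph_base_pole.
exact: sphere_baseP.
Qed.

End Spheres.

Section Wedges.
Variables (I : finType) (S : topologicalType) (p : S).
Hypothesis clp : closed [set p].
Local Notation wlift i := (@wedge_lift I (fun=> S) (fun=> p) i).
Local Notation W := (@wedge I (fun=> S) (fun=> p)).

Definition wcoord (i : I) (w : W) : S := wedge_prod w i.

Lemma wcoord_continuous i : continuous (wcoord i).
Proof.
apply: (@cont_comp _ (prod_topology (fun _ : I => S)) _ (@wedge_prod I (fun=> S) (fun=> p))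
  (fun u => u i)).
  exact: wedge_prod_continuous.
exact: (@proj_continuous _ (fun=> S) i).
Qed.

Lemma wcoord_inj w w' : (forall i, wcoord i w = wcoord i w') -> w = w'.
Proof. by move=> ww'; apply: wedge_prod_inj; exact/funext. Qed.

Lemma wcoord_lift i (x : S) j :
  wcoord j (wlift i x) = if j == i then x else p.
Proof.
rewrite /wcoord /wedge_prod wedge_lift_funE; last exact: wedge_prod_pointE.
by have [->|ji] := eqVneq j i; [rewrite dfwithin | rewrite dfwithout // eq_sym].
Qed.

Lemma wcoord_support (w : W) : exists i, forall j, j != i -> wcoord j w = p.
Proof.
have : [set: W] w by [].
rewrite -wedgeTE => -[i _ [x _ <-]]; exists i => j ji.
by rewrite wcoord_lift (negbTE ji).
Qed.

(** A finite wedge is embedded in the product of its summands, with image the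
    tuples having at most one coordinate off the base point; so continuity of
    a map into the wedge is a matter of coordinates. *)
Lemma wedge_coord_lift (Z : topologicalType) (c : Z -> I -> S) :
  (forall i, continuous (c^~ i)) ->
  (forall z, exists i, forall j, j != i -> c z j = p) ->
  exists F : Z -> W, continuous F /\ forall z i, wcoord i (F z) = c z i.
Proof.
move=> cc supp1.
have [F FE] : exists F : Z -> W, forall z i, wcoord i (F z) = c z i.
  suff /choice[F FE] : forall z, exists w : W, forall i, wcoord i w = c z i by exists F.
  move=> z; have [i ci] := supp1 z.
  exists (wlift i (c z i)) => j; rewrite wcoord_lift.
  by have [->//|/ci] := eqVneq j i.
exists F; split=> // z U nU.
(* The image of [U] is a neighborhood in the image of the wedge only. *)
have nP : @nbhs _ (prod_topology (fun _ : I => S)) (wedge_prod (F z))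
    [set u | range (@wedge_prod I (fun=> S) (fun=> p)) u ->
             exists2 w, U w & wedge_prod w = u].
  have := @wedge_prod_open _ _ _ (F z) U (@finite_finset _ [set: I]) (fun=> clp) nU.
  by rewrite {1}/nbhs /= -nbhs_subspace_in //; exists (F z).
have cF : continuous (fun z => wedge_prod (F z) : prod_topology (fun _ : I => S)).
  move=> x; apply/cvg_sup => i; apply/cvg_image; last first.
    move=> V nV; exists ((fun u : prod_topology (fun _ : I => S) => u i) @^-1` V).
      have nV' : nbhs (c x i) V by rewrite -FE.
      have := cc i x V nV'; rewrite nbhs_simpl /=; apply: filterS => y /=.
      by rewrite -FE.
    apply/seteqP; split=> [_ [u Uu <-]//|a Ua]; exists (fun=> a) => //.
  by apply/seteqP; split=> // a _; exists (fun=> a).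
have := cF z _ nP; rewrite nbhs_simpl /=; apply: filterS => y /= [|w Uw /wedge_prod_inj <-//].
by exists (F y).
Qed.

End Wedges.

(** * The join of an octahedral sphere with finitely many points *)

Section Join.
Variables (J : finType) (r : nat).

(** [inl (j, true)] and [inl (j, false)] are opposite vertices of the
    octahedral sphere; the points joined to it are counted from [None] because
    the hemisphere over that point is the one to be collapsed. *)
Definition join_conflict : rel ((J * bool) + option 'I_r) := fun x y =>
  match x, y with
  | inl a, inl b => (a.1 == b.1) && (a.2 != b.2)
  | inr p, inr q => p != q
  | _, _ => false
  end.

Definition join_complex := indep_complex join_conflict.

End Join.

Section Suspension.
Variable R : realType.

Definition pos (a : R) : R := Num.max 0 a.

Lemma pos_ge0 a : 0 <= pos a.
Proof. by rewrite /pos le_max lexx. Qed.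

Lemma pos_id a : 0 <= a -> pos a = a.
Proof. by move=> a0; rewrite /pos max_r. Qed.

Lemma pos0 a : a <= 0 -> pos a = 0.
Proof. by move=> a0; rewrite /pos max_l. Qed.

Lemma posBN a : pos a - pos (- a) = a.
Proof.
have [a0|a0] := leP 0 a; first by rewrite pos_id // pos0 ?subr0 // oppr_le0.
by rewrite pos0 ?(ltW a0) // pos_id ?sub0r ?opprK // oppr_ge0 ltW.
Qed.

Lemma posDN a : pos a + pos (- a) = `|a|.
Proof.
have [a0|a0] := leP 0 a; first by rewrite pos_id // pos0 ?addr0 ?ger0_norm // oppr_le0.
by rewrite pos0 ?(ltW a0) // pos_id ?add0r ?ltr0_norm // oppr_ge0 ltW.
Qed.

Lemma posM c a : 0 <= c -> pos (c * a) = c * pos a.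
Proof. by move=> c0; rewrite /pos maxr_pMr // mulr0. Qed.

Lemma pos_neq0 a : (pos a != 0) = (0 < a).
Proof.
have [a0|a0] := ltP 0 a; first by rewrite pos_id ?gt_eqF // ltW.
by rewrite pos0 // eqxx.
Qed.

Lemma pos_continuous (X : topologicalType) (f : X -> R) :
  continuous f -> continuous (fun x => pos (f x)).
Proof. by move=> cf; apply: cont_max => //; exact: contC. Qed.

(** The deformation of the sphere with polar coordinate [s] and equatorial
    coordinates [z], up to positive scaling: [(s, z)] moves to
    [(drift t s, shrink t s * z)].  At [t = 1] the hemisphere [0 <= s] has
    been collapsed to the pole and the other one is spread over the sphere. *)
Definition drift t s : R := (1 - t) * s + t * (1 - 2 * pos (- s)).
Definition shrink t s : R := (1 - t) + t * pos (- s).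

(** The equatorial part vanishes only when it does so at the start, that is at
    the poles, which stay fixed, or when [t = 1] on the collapsed hemisphere,
    which is then at the pole. *)
Lemma drift_neq0 (J : finType) t s (z : J -> R) : 0 <= t <= 1 ->
  `|s| + \sum_k `|z k| = 1 ->
  drift t s != 0 \/ exists k, shrink t s * z k != 0.
Proof.
move=> t01 sz1; have /andP[t0 t1] := t01; rewrite /drift /shrink.
have [/existsP[k zk]|/existsPn z0] := boolP [exists k, z k != 0].
  have [r0|r0] := eqVneq (1 - t + t * pos (- s)) 0; last first.
    by right; exists k; rewrite mulf_neq0.
  have pt := pos_ge0 (- s).
  have tp : 0 <= t * pos (- s) by rewrite mulr_ge0.
  have t1' : t = 1 by lra.
  have ps : pos (- s) = 0 by move: r0; rewrite t1' mul1r; lra.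
  by left; rewrite ps t1' subrr mul0r mulr0 subr0 mul1r add0r oner_neq0.
left; move: sz1; rewrite big1 => [|k _]; last first.
  by apply/eqP; rewrite normr_eq0; have := z0 k; rewrite negbK.
rewrite addr0; have [s0|s0] := leP 0 s.
  rewrite ger0_norm // => ->.
  by rewrite pos0 ?lerN10 // mulr0 subr0 !mulr1 subrK oner_neq0.
rewrite ltr0_norm // => s1; have -> : s = -1 by rewrite -s1 opprK.
rewrite opprK pos_id ?ler01 //; apply/eqP; lra.
Qed.

Section Profile.
Variables (J : finType) (r : nat).
Local Notation V := ((J * bool) + option 'I_r)%type.
Local Notation L := (join_complex J r).

(** The point with polar coordinate [s] and equatorial coordinates [z] on the
    octahedral sphere formed by the hemispheres numbered [None] and [Some i]
    of the join of the cross-polytope on [J] and the [r.+1] points. *)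
Definition profile (i : 'I_r) (s : R) (z : J -> R) (v : V) : R :=
  match v with
  | inl (k, b) => pos (if b then z k else - z k)
  | inr None => pos s
  | inr (Some j) => if j == i then pos (- s) else 0
  end.

Lemma sum_vertices (u : V -> R) :
  \sum_v u v = u (inr None) + \sum_j u (inr (Some j)) +
    \sum_k (u (inl (k, true)) + u (inl (k, false))).
Proof.
rewrite big_sumType /= addrC; congr (_ + _).
  by rewrite (bigD1 None) //=; congr (_ + _); rewrite (reindex_omap Some id) //=;
    [apply: eq_bigl => j; rewrite eqxx | case].
rewrite (eq_bigr (fun p => u (inl (p.1, p.2)))); last by case.
rewrite -(pair_bigA _ (fun k b => u (inl (k, b)))) /=.
by apply: eq_bigr => k _; rewrite big_bool.
Qed.

Lemma profile_ge0 i s z v : 0 <= profile i s z v.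
Proof.
case: v => [[k b]|[j|]]; rewrite /= ?pos_ge0 //.
by case: ifP; rewrite ?pos_ge0.
Qed.

Lemma profile_sum i s z : \sum_v profile i s z v = `|s| + \sum_k `|z k|.
Proof.
rewrite sum_vertices /= -big_mkcond big_pred1_eq posDN; congr (_ + _).
by apply: eq_bigr => k _; rewrite posDN.
Qed.

Lemma profile_scale i c s z v : 0 <= c ->
  profile i (c * s) (fun k => c * z k) v = c * profile i s z v.
Proof.
move=> c0; case: v => [[k b]|[j|]] /=; rewrite -?mulrN ?posM //.
  by case: b; rewrite posM.
by case: ifP; rewrite ?posM // mulr0.
Qed.

(** [s] and [- s] are not both positive, nor are [z k] and [- z k]: no two
    conflicting vertices get weight. *)
Lemma profile_supp i s z : s != 0 \/ (exists k, z k != 0) ->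
  supp (profile i s z) \in simplices L.
Proof.
move=> sz; apply/indepP; split.
  apply/set0Pn; case: sz => [s0|[k k0]].
    have [s0'|s0'] := ltP 0 s.
      by exists (inr None); rewrite finset.inE /= pos_neq0.
    exists (inr (Some i)); rewrite finset.inE /= eqxx pos_neq0 oppr_gt0.
    by rewrite lt_neqAle s0.
  have [k0'|k0'] := ltP 0 (z k).
    by exists (inl (k, true)); rewrite finset.inE /= pos_neq0.
  exists (inl (k, false)); rewrite finset.inE /= pos_neq0 oppr_gt0.
  by rewrite lt_neqAle k0.
have signs k b b' : pos (if b then z k else - z k) != 0 ->
    pos (if b' then z k else - z k) != 0 -> b = b'.
  by rewrite !pos_neq0; case: b; case: b' => //; rewrite oppr_gt0 => ? ?; lra.
move=> [[k b]|[j|]] [[k' b']|[j'|]]; rewrite !finset.inE //=.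
- by have [<- kb /(signs _ _ _ kb) ->|] := eqVneq k k'; rewrite ?eqxx.
- have [->|] := eqVneq j i; last by rewrite eqxx.
  by have [->|] := eqVneq j' i; rewrite eqxx.
- by case: ifP; rewrite ?eqxx // !pos_neq0 oppr_gt0 => _ ? ?; lra.
- by case: ifP; rewrite ?eqxx // !pos_neq0 oppr_gt0 => _ ? ?; lra.
Qed.

(** A point of the join has at most one nonzero height, so it lies on one of
    the octahedral spheres; if that height is over [None], or if the point is
    on the equator, any [i] will do. *)
Lemma join_profile (x : realization R L) : (0 < r)%N ->
  exists i s z, bary x = profile i s z.
Proof.
move=> r0.
have /indepP[_ xc] := bary_supp x.
have zero v w : join_conflict v w -> bary x v != 0 -> bary x w = 0.
  move=> vw v0; apply/eqP/negPn/negP => w0.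
  by have := xc v w; rewrite !finset.inE vw => /(_ v0 w0).
have [i ix] : exists i, forall j, j != i -> bary x (inr (Some j)) = 0.
  have [/existsP[i xi]|/existsPn x0] := boolP [exists i, bary x (inr (Some i)) != 0].
    exists i => j ji; apply: (zero (inr (Some i))) xi.
    by rewrite /= eq_sym; apply: contraNneq ji => -[->].
  by exists (Ordinal r0) => j _; apply/eqP; have := x0 j; rewrite negbK.
exists i, (bary x (inr None) - bary x (inr (Some i))),
  (fun k => bary x (inl (k, true)) - bary x (inl (k, false))).
have split_pos v w : join_conflict v w ->
    bary x v = pos (bary x v - bary x w) /\ bary x w = pos (- (bary x v - bary x w)).
  move=> vw; have v0 := bary_ge0 x v; have w0 := bary_ge0 x w.
  have [v00|/(zero _ _ vw) w00] := eqVneq (bary x v) 0.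
    by rewrite v00 sub0r opprK pos0 ?oppr_le0 // pos_id.
  by rewrite w00 subr0 pos_id // pos0 // oppr_le0.
apply/funext => -[[k b]|[j|]] /=.
- have [|pt pf] := @split_pos (inl (k, true)) (inl (k, false)).
    by rewrite /= eqxx.
  by case: b.
- have [ei eN] := @split_pos (inr None) (inr (Some i)) isT.
  by have [->|/ix] := eqVneq j i.
- by have [ei eN] := @split_pos (inr None) (inr (Some i)) isT.
Qed.

End Profile.
End Suspension.

(** * Collapsing one hemisphere *)

Section JoinWedge.
Variables (R : realType) (J : finType).
Local Notation S := (sphere R #|J|).
Local Notation base := (sphere_base R #|J|).

Lemma normalized_scale (V : finType) c (u u' : V -> R) : c != 0 ->
  (forall v, u v = c * u' v) -> forall v, u v / \sum_s u s = u' v / \sum_s u' s.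
Proof.
move=> c0 uu' v; rewrite uu' (eq_bigr (fun s => c * u' s)) // -mulr_sumr.
by rewrite -mulf_div divff // mul1r.
Qed.

(** A ray from the origin meets the sphere once. *)
Lemma sph_ray (w w' : S) c c' a (z : J -> R) : 0 < c -> 0 < c' ->
  sph_pole w = c * a -> (forall k, sph_eq w k = c * z k) ->
  sph_pole w' = c' * a -> (forall k, sph_eq w' k = c' * z k) -> w = w'.
Proof.
move=> c0 c'0 wa wz wa' wz'.
have nrm (v : S) d : sph_pole v = d * a -> (forall k, sph_eq v k = d * z k) ->
    d ^+ 2 * (a ^+ 2 + \sum_k z k ^+ 2) = 1.
  move=> va vz; rewrite -(sph_norm v) va exprMn mulrDr mulr_sumr; congr (_ + _).
  by apply: eq_bigr => k _; rewrite vz exprMn.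
have n1 := nrm w c wa wz; have n2 := nrm w' c' wa' wz'.
have /eqP : c ^+ 2 = c' ^+ 2.
  apply: (@mulIf _ (a ^+ 2 + \sum_k z k ^+ 2)); last by rewrite n1 n2.
  by apply/eqP => q0; move: n1; rewrite q0 mulr0 => /eqP; rewrite eq_sym oner_eq0.
rewrite eqrXn2 ?ltW // => /eqP cc'.
by apply: sph_ext => [|k]; rewrite ?wa ?wa' ?wz ?wz' cc'.
Qed.

Definition sph_l1 (w : S) : R := `|sph_pole w| + \sum_k `|sph_eq w k|.

Lemma sph_l1_gt0 w : 0 < sph_l1 w.
Proof.
have z0 : 0 <= \sum_k `|sph_eq w k| by apply: sumr_ge0.
rewrite lt_neqAle addr_ge0 // andbT eq_sym paddr_eq0 // normr_eq0.
apply/negP => /andP[/eqP w0]; rewrite psumr_eq0 // => /allP wz.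
have := sph_norm w; rewrite w0 expr0n add0r big1 => [/eqP|k _].
  by rewrite eq_sym oner_eq0.
have := wz k; rewrite mem_index_enum normr_eq0 => /(_ isT) /eqP ->.
by rewrite expr0n.
Qed.

Lemma sph_l1_norm w : `|(sph_l1 w)^-1 * sph_pole w| +
  \sum_k `|(sph_l1 w)^-1 * sph_eq w k| = 1.
Proof.
have l0 := sph_l1_gt0 w.
under eq_bigr do rewrite normrM.
by rewrite normrM gtr0_norm ?invr_gt0 // -mulr_sumr -mulrDr mulVf ?gt_eqF.
Qed.

Lemma sph_l1_continuous : continuous sph_l1.
Proof.
apply: contD; first exact/cont_norm/sph_pole_continuous.
by apply: cont_sum => k _; exact/cont_norm/sph_eq_continuous.
Qed.

Lemma drift_continuous (X : topologicalType) (t s : X -> R) :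
  continuous t -> continuous s -> continuous (fun x => drift (t x) (s x)).
Proof.
move=> ct cs; apply: contD; apply: contM => //.
  by apply: contD; [exact: contC | exact: contN].
apply: contD; first exact: contC.
apply: contN; apply: contM; first exact: contC.
by apply: pos_continuous; exact: contN.
Qed.

Lemma shrink_continuous (X : topologicalType) (t s : X -> R) :
  continuous t -> continuous s -> continuous (fun x => shrink (t x) (s x)).
Proof.
move=> ct cs; apply: contD; first by apply: contD; [exact: contC | exact: contN].
by apply: contM => //; apply: pos_continuous; exact: contN.
Qed.

Lemma drift0 s : drift 0 s = s :> R.
Proof. by rewrite /drift subr0 mul1r mul0r addr0. Qed.

Lemma shrink0 s : shrink 0 s = 1 :> R.
Proof. by rewrite /shrink mul0r addr0 subr0. Qed.

Lemma drift1 s : drift 1 s = 1 - 2 * pos (- s) :> R.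
Proof. by rewrite /drift subrr mul0r mul1r add0r. Qed.

Lemma shrink1 s : shrink 1 s = pos (- s) :> R.
Proof. by rewrite /shrink subrr mul1r add0r. Qed.

(** The drift on a Euclidean sphere, through the octahedral sphere: rays are
    rescaled to octahedral coordinates, moved, and rescaled back. *)
Lemma sphere_drift : exists G : S * R -> S, continuous G /\
  forall w t, exists2 c, 0 < c &
    sph_pole (G (w, t)) = c * drift (clamp t) ((sph_l1 w)^-1 * sph_pole w) /\
    forall k, sph_eq (G (w, t)) k = c *
      (shrink (clamp t) ((sph_l1 w)^-1 * sph_pole w) * ((sph_l1 w)^-1 * sph_eq w k)).
Proof.
have cl : continuous (fun z : S * R => (sph_l1 z.1)^-1).
  apply: contV => [z|]; first by rewrite gt_eqF // sph_l1_gt0.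
  exact: cont_comp (@cont_fst _ _) sph_l1_continuous.
have ct : continuous (fun z : S * R => clamp z.2).
  exact: cont_comp (@cont_snd _ _) (@clamp_continuous R).
have cp : continuous (fun z : S * R => (sph_l1 z.1)^-1 * sph_pole z.1).
  by apply: contM => //; exact: cont_comp (@cont_fst _ _) (@sph_pole_continuous _ _).
have [|||G [cG GE]] := @sphere_lift R J (S * R)%type
  (fun z => drift (clamp z.2) ((sph_l1 z.1)^-1 * sph_pole z.1))
  (fun z k => shrink (clamp z.2) ((sph_l1 z.1)^-1 * sph_pole z.1) *
              ((sph_l1 z.1)^-1 * sph_eq z.1 k)).
- exact: drift_continuous.
- move=> k; apply: contM; first exact: shrink_continuous.
  by apply: contM => //; exact: cont_comp (@cont_fst _ _) (@sph_eq_continuous _ _ k).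
- by move=> z; apply: drift_neq0; [exact: clamp_itv | exact: sph_l1_norm].
by exists G; split=> // w t; have := GE (w, t).
Qed.

Section Wedge.
Variable r : nat.
Local Notation I := 'I_r.+1.
Local Notation L := (join_complex J r.+1).
Local Notation X := (realization R L).
Local Notation W := (@wedge I (fun=> S) (fun=> base)).

Definition height (x : X) (j : I) : R := bary x (inr (Some j)).
Definition equator (x : X) (k : J) : R :=
  bary x (inl (k, true)) - bary x (inl (k, false)).

Lemma height_continuous j : continuous (height^~ j).
Proof. exact: bary_continuous. Qed.

Lemma equator_continuous k : continuous (equator^~ k).
Proof.
by apply: contD; [exact: bary_continuous | apply: contN; exact: bary_continuous].
Qed.

Lemma height_profile (x : X) (i : I) s z : bary x = profile i s z ->
  forall j, height x j = if j == i then pos (- s) else 0.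
Proof. by move=> xE j; rewrite /height xE. Qed.

Lemma equator_profile (x : X) (i : I) s z : bary x = profile i s z ->
  forall k, equator x k = z k.
Proof. by move=> xE k; rewrite /equator xE /= posBN. Qed.

Lemma profile_norm (x : X) (i : I) s z : bary x = profile i s z ->
  `|s| + \sum_k `|z k| = 1.
Proof. by move=> xE; rewrite -(profile_sum i) -xE bary_sum. Qed.

(** The time-one drift in the coordinates of the [j]-th sphere only involves
    the height over [Some j], and a point of height 0 goes to the base point. *)
Lemma collapse : exists f : X -> W, continuous f /\
  forall (x : X) (i : I) s z, bary x = profile i s z ->
  (exists2 c, 0 < c & sph_pole (wcoord i (f x)) = c * drift 1 s /\
    forall k, sph_eq (wcoord i (f x)) k = c * (shrink 1 s * z k)) /\
  (forall j, j != i -> wcoord j (f x) = base).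
Proof.
have /choice[F FE] (j : I) : exists F : X -> S, continuous F /\
    forall x, exists2 c, 0 < c & sph_pole (F x) = c * (1 - 2 * height x j) /\
      forall k, sph_eq (F x) k = c * (height x j * equator x k).
  apply: sphere_lift.
  - apply: contD; first exact: contC.
    by apply: contN; apply: contM; [exact: contC | exact: height_continuous].
  - by move=> k; apply: contM; [exact: height_continuous | exact: equator_continuous].
  - move=> x; have [//|i [s [z xE]]] := join_profile x.
    rewrite (height_profile xE); have [ji|ji] := eqVneq j i; last first.
      by left; rewrite mulr0 subr0 oner_neq0.
    have [] := @drift_neq0 R J 1 s z _ (profile_norm xE).
    + by rewrite ler01 lexx.
    + by rewrite drift1; left.
    + by rewrite shrink1 => -[k zk]; right; exists k; rewrite (equator_profile xE).
have Fi (x : X) (i : I) s z : bary x = profile i s z -> forall j, j != i -> F j x = base.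
  move=> xE j ji; have [_ /(_ x)[c c0]] := FE j.
  rewrite (height_profile xE) (negbTE ji) mulr0 subr0 => -[wp we].
  apply: (@sph_ray _ _ c 1 1 (fun=> 0)) => //; first by move=> k; rewrite we mul0r.
    by rewrite sph_base_pole mul1r.
  by move=> k; rewrite sph_base_eq mulr0.
have [||f [cf fE]] := @wedge_coord_lift I S base (@closed_sphere_base R J) X
  (fun x j => F j x).
- by move=> j; have [] := FE j.
- by move=> x; have [//|i [s [z xE]]] := join_profile x; exists i; exact: Fi xE.
exists f; split=> // x i s z xE; split; last by move=> j ji; rewrite fE (Fi _ _ _ _ xE).
have [_ /(_ x)[c c0]] := FE i; rewrite (height_profile xE) eqxx => -[wp we].
exists c; rewrite // fE drift1 shrink1; split=> // k.
by rewrite we (equator_profile xE).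
Qed.

(** Off the sphere [i] all polar coordinates are 1 and all equatorial ones 0.
    The equatorial coordinates can therefore be summed over all spheres, and
    [1 + \sum_j (pole_j - 1)] is the polar coordinate on sphere [i]. *)
Lemma wedge_to_join : exists g : W -> X, continuous g /\
  forall w (i : I), (forall j, j != i -> wcoord j w = base) ->
  bary (g w) = profile i ((sph_l1 (wcoord i w))^-1 * sph_pole (wcoord i w))
                 (fun k => (sph_l1 (wcoord i w))^-1 * sph_eq (wcoord i w) k).
Proof.
pose u (w : W) (v : (J * bool) + option I) : R :=
  match v with
  | inl (k, b) => let z := \sum_j sph_eq (wcoord j w) k in pos (if b then z else - z)
  | inr None => pos (1 + \sum_j (sph_pole (wcoord j w) - 1))
  | inr (Some j) => pos (- sph_pole (wcoord j w))
  end.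
have uE w (i : I) : (forall j, j != i -> wcoord j w = base) ->
    u w = profile i (sph_pole (wcoord i w)) (sph_eq (wcoord i w)).
  move=> wi; apply/funext => -[[k b]|[j|]] /=.
  - rewrite (bigD1 i) //= big1 ?addr0 // => j ji.
    by rewrite wi // sph_base_eq.
  - have [->//|ji] := eqVneq j i.
    by rewrite wi // sph_base_pole pos0 // lerN10.
  - rewrite (bigD1 i) //= big1 ?addr0; first by rewrite addrC subrK.
    by move=> j ji; rewrite wi // sph_base_pole subrr.
have cw (h : S -> R) j : continuous h -> continuous (fun w : W => h (wcoord j w)).
  by move=> ch; apply: cont_comp ch; exact: wcoord_continuous.
have [|||g [cg gE]] := @realization_lift R _ L W u.
- move=> [[k b]|[j|]] /=.
  + have cz : continuous (fun w : W => \sum_j sph_eq (wcoord j w) k).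
      by apply: cont_sum => j _; apply: (cw (fun y => sph_eq y k)); exact: sph_eq_continuous.
    by case: b; apply: pos_continuous => //; exact: contN.
  + by apply: pos_continuous; apply: contN; apply: (cw (@sph_pole R J)); exact: sph_pole_continuous.
  + apply: pos_continuous; apply: contD; first exact: contC.
    apply: cont_sum => j _; apply: contD; last exact: contC.
    by apply: (cw (@sph_pole R J)); exact: sph_pole_continuous.
- by move=> w v; have [i wi] := wcoord_support w; rewrite (uE _ _ wi) profile_ge0.
- move=> w; have [i wi] := wcoord_support w; rewrite (uE _ _ wi).
  apply: profile_supp; have [/existsP[k k0]|/existsPn z0] :=
    boolP [exists k, sph_eq (wcoord i w) k != 0]; first by right; exists k.
  left; apply/eqP => p0; have := sph_norm (wcoord i w).
  rewrite p0 expr0n add0r big1 => [/eqP|k _]; first by rewrite eq_sym oner_eq0.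
  by have := z0 k; rewrite negbK => /eqP ->; rewrite expr0n.
exists g; split=> // w i wi; apply/funext => v; rewrite gE (uE _ _ wi).
rewrite profile_sum -/(sph_l1 _) mulrC profile_scale //.
by rewrite invr_ge0 ltW // sph_l1_gt0.
Qed.

(** The drift on the union of the octahedral spheres.  With [Y] the sum of the
    heights over the points other than [None], the polar coordinate is
    [bary x (inr None) - Y x] and its negative part is [Y x]; this gives
    formulas free of the choice of a sphere through [x]. *)
Lemma join_drift : exists H : X * R -> X, continuous H /\
  forall (x : X) t (i : I) s z, bary x = profile i s z -> forall v,
  let u := profile i (drift (clamp t) s) (fun k => shrink (clamp t) s * z k) in
  bary (H (x, t)) v = u v / \sum_v u v.
Proof.
pose Y (x : X) := \sum_j height x j.
pose c (q : X * R) := clamp q.2.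
pose u (q : X * R) (v : (J * bool) + option I) : R :=
  match v with
  | inl (k, b) => let z := shrink (c q) (- Y q.1) * equator q.1 k in
                  pos (if b then z else - z)
  | inr None => pos ((1 - c q) * (bary q.1 (inr None) - Y q.1) + c q * (1 - 2 * Y q.1))
  | inr (Some j) => pos (- ((1 - c q) * - height q.1 j + c q * (1 - 2 * height q.1 j)))
  end.
have Y_profile (x : X) (i : I) s z : bary x = profile i s z -> Y x = pos (- s).
  move=> xE; rewrite /Y (bigD1 i) //= (height_profile xE) eqxx big1 ?addr0 // => j ji.
  by rewrite (height_profile xE) (negbTE ji).
have uE (x : X) t (i : I) s z : bary x = profile i s z ->
    u (x, t) = profile i (drift (clamp t) s) (fun k => shrink (clamp t) s * z k).
  move=> xE; have /andP[t0 t1] := clamp_itv t.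
  have ps := pos_ge0 (- s); have sE := posBN s.
  apply/funext => -[[k b]|[j|]]; rewrite /u /= /c /=.
  - rewrite (Y_profile _ _ _ _ xE) (equator_profile xE) /shrink opprK (pos_id ps).
    by [].
  - rewrite (height_profile xE); have [ji|ji] := eqVneq j i; last first.
      by rewrite oppr0 !mulr0 subr0 mulr1 add0r pos0 // oppr_le0.
    rewrite /drift; have [s0|s0] := leP 0 s; last first.
      by have -> : - pos (- s) = s by rewrite pos_id ?opprK // oppr_ge0 ltW.
    have -> : pos (- s) = 0 by rewrite pos0 ?oppr_le0.
    rewrite oppr0 !mulr0 subr0 mulr1 add0r.
    rewrite !pos0 // oppr_le0 // addr_ge0 // mulr_ge0 // subr_ge0 //.
  - by rewrite (Y_profile _ _ _ _ xE) xE /= sE.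
have cc : continuous c := cont_comp (@cont_snd _ _) (@clamp_continuous R).
have ch j : continuous (fun q : X * R => height q.1 j).
  exact: cont_comp (@cont_fst _ _) (@height_continuous j).
have cY : continuous (fun q : X * R => Y q.1) by apply: cont_sum.
have c1 : continuous (fun q : X * R => 1 - c q).
  by apply: contD; [exact: contC | exact: contN].
have c2 (h : X * R -> R) : continuous h -> continuous (fun q => c q * (1 - 2 * h q)).
  move=> chh; apply: contM => //; apply: contD; first exact: contC.
  by apply: contN; apply: contM => //; exact: contC.
have [|||H [cH HE]] := @realization_lift R _ L (X * R)%type u.
- move=> [[k b]|[j|]] /=.
  + have cz : continuous (fun q : X * R => shrink (c q) (- Y q.1) * equator q.1 k).
      apply: contM; first by apply: shrink_continuous => //; exact: contN.
      exact: cont_comp (@cont_fst _ _) (@equator_continuous k).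
    by case: b; apply: pos_continuous => //; exact: contN.
  + apply: pos_continuous; apply: contN; apply: contD; last exact: c2.
    by apply: contM => //; exact: contN.
  + apply: pos_continuous; apply: contD; last exact: c2.
    apply: contM => //; apply: contD; last exact: contN.
    exact: cont_comp (@cont_fst _ _) (@bary_continuous R _ L (inr None)).
- move=> [x t] v; have [//|i [s [z xE]]] := join_profile x.
  by rewrite (uE _ _ _ _ _ xE) profile_ge0.
- move=> [x t]; have [//|i [s [z xE]]] := join_profile x.
  rewrite (uE _ _ _ _ _ xE); apply: profile_supp; apply: drift_neq0.
    exact: clamp_itv.
  exact: profile_norm xE.
by exists H; split=> // x t i s z xE v; rewrite HE (uE _ _ _ _ _ xE).
Qed.

(** Both composites are the time-one drift, which is homotopic to the
    identity through the drift at times between 0 and 1. *)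
Lemma join_wedge : homotopy_equivalent R X W.
Proof.
have [f [cf fE]] := collapse; have [g [cg gE]] := wedge_to_join.
exists f, g; split=> //.
- have [H [cH HE]] := join_drift.
  (* Time is reversed, the drift starting at the identity. *)
  have cH' : continuous (fun q : X * R => H (q.1, 1 - q.2)).
    apply: cont_comp cH; apply: cont_pair; first exact: cont_fst.
    by apply: contD; [exact: contC | apply: contN; exact: cont_snd].
  apply: (homotopic_total cH') => x; have [//|i [s [z xE]]] := join_profile x;
    apply/bary_inj/funext => v; rewrite (HE _ _ _ _ _ xE) /=.
  + rewrite subr0 clamp1.
    have [[c c0 [fp fz]] fi] := fE x i s z xE.
    symmetry.
    have c'0 : c * (sph_l1 (wcoord i (f x)))^-1 != 0.
      by rewrite mulf_neq0 ?invr_eq0 // gt_eqF // sph_l1_gt0.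
    transitivity (bary (g (f x)) v / \sum_t bary (g (f x)) t).
      by rewrite bary_sum divr1.
    apply: (normalized_scale c'0) => y; rewrite (gE _ _ fi) fp.
    rewrite (_ : (fun k => _) = fun k => c * (sph_l1 (wcoord i (f x)))^-1 * (shrink 1 s * z k)).
      rewrite [_ * (c * _)]mulrCA mulrA profile_scale //.
      by apply: mulr_ge0; [exact: ltW | rewrite invr_ge0; exact/ltW/sph_l1_gt0].
    by apply/funext => k; rewrite fz; ring.
  + rewrite subrr clamp0.
    have -> : profile i (drift 0 s) (fun k => shrink 0 s * z k) = bary x.
      by rewrite xE drift0 shrink0; congr profile; apply/funext => k; rewrite mul1r.
    by rewrite bary_sum divr1.
- have [G [cG GE]] := sphere_drift.
  (* The base point is fixed, so the drift acts on the wedge. *)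
  have GB t : G (base, t) = base.
    have [c c0] := GE base t.
    have -> : sph_l1 base = 1.
      rewrite /sph_l1 sph_base_pole normr1 big1 ?addr0 // => k _.
      by rewrite sph_base_eq normr0.
    rewrite invr1 !mul1r sph_base_pole => -[Gp Gz].
    apply: (@sph_ray _ _ c 1 1 (fun=> 0)) => //.
    - rewrite Gp /drift pos0 ?lerN10 //; ring.
    - by move=> k; rewrite Gz sph_base_eq !mulr0.
    - by rewrite sph_base_pole mulr1.
    - by move=> k; rewrite sph_base_eq mulr0.
  have [||H [cH HE]] := @wedge_coord_lift I S base (@closed_sphere_base R J)
    (W * R)%type (fun q j => G (wcoord j q.1, 1 - q.2)).
  + move=> j; apply: cont_comp cG; apply: cont_pair.
      by apply: cont_comp (@wcoord_continuous _ _ _ j); exact: cont_fst.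
    by apply: contD; [exact: contC | apply: contN; exact: cont_snd].
  + by move=> [w t]; have [i wi] := wcoord_support w; exists i => j ji; rewrite wi.
  apply: (homotopic_total cH) => w; apply: wcoord_inj => j; rewrite HE /=.
  + have [i wi] := wcoord_support w.
    have [[c c0 [fp fz]] fi] := fE _ _ _ _ (gE w i wi).
    have [->|ji] := eqVneq j i; last by rewrite fi // wi.
    have [c' c'0] := GE (wcoord i w) (1 - 0).
    rewrite subr0 clamp1 => -[Gp Gz].
    exact: sph_ray c'0 c0 Gp Gz fp fz.
  + have [c c0] := GE (wcoord j w) (1 - 1).
    rewrite subrr clamp0 drift0 shrink0 => -[Gp Gz].
    have l0 := sph_l1_gt0 (wcoord j w).
    apply: (@sph_ray _ _ (c / sph_l1 (wcoord j w)) 1 (sph_pole (wcoord j w))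
       (sph_eq (wcoord j w))) => //.
    - by rewrite divr_gt0.
    - by rewrite Gp mulrA.
    - by move=> k; rewrite Gz mul1r mulrA.
    - by rewrite mul1r.
    - by move=> k; rewrite mul1r.
Qed.


End Wedge.
End JoinWedge.

Section WedgeSpheres.
Variables (R : realType) (J : finType).

(** With a single point to join with, the join is a cone: every point is
    joined to the apex by a straight line. *)
Lemma join_cone (Y : topologicalType) (y0 : Y) : (forall y, y = y0) ->
  homotopy_equivalent R (realization R (join_complex J 0)) Y.
Proof.
move=> Y1; set L := join_complex J 0.
pose u (y : Y) (v : (J * bool) + option 'I_0) : R := (v == inr None)%:R.
have su y : supp (u y) = [set inr None]%SET.
  by apply/setP => v; rewrite !finset.inE /u pnatr_eq0 eqb0 negbK.
have [|||g [cg gE]] := @realization_lift R _ L Y u.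
- by move=> v; exact: contC.
- by move=> y v; rewrite ler0n.
- move=> y; rewrite su; apply/indepP; split.
    by apply/set0Pn; exists (inr None); rewrite finset.inE.
  by move=> v w; rewrite !finset.inE => /eqP-> /eqP->.
have sg y : supp (bary (g y)) \subset [set inr None]%SET.
  apply/fintype.subsetP => v; rewrite -(su y) !finset.inE gE.
  by apply: contra_neq => ->; rewrite mul0r.
exists (fun=> y0), g; split=> //.
- exact: cst_continuous.
- apply: straight_line_homotopic => [||x].
  + by apply: cont_comp cg; exact: cst_continuous.
  + by move=> x.
  have /indepP[x0 xc] := bary_supp x.
  apply/indepP; split.
    by case/set0Pn: x0 => v vx; apply/set0Pn; exists v; rewrite finset.inE vx orbT.
  have apex v w : v \in supp (bary (g y0)) -> ~~ join_conflict v w /\ ~~ join_conflict w v.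
    move/(fintype.subsetP (sg y0)); rewrite finset.inE => /eqP ->.
    by case: w => [a|[[a //]|]]; rewrite /= ?eqxx.
  move=> v w; rewrite !finset.in_setU => /orP[/apex h _|vx]; first by case: (h w).
  by case/orP => [/apex h|wx]; [case: (h v) | exact: xc].
- by apply: (homotopic_total (@cont_fst Y R)) => y; rewrite [RHS]Y1 [LHS]Y1.
Qed.

Lemma join_wedge_spheres r :
  homotopy_equivalent R (realization R (join_complex J r)) (wedge_spheres R r #|J|).
Proof.
case: r => [|r]; last exact: join_wedge.
have pole_in : sphere_base R #|J| \in [set sphere_base R #|J|] by apply/mem_set.
pose y0 : wedge_spheres R 0 #|J| :=
  exist (fun x => x \in [set sphere_base R #|J|]) _ pole_in.
apply: (join_cone (y0 := y0)) => -[y yP].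
by apply: val_inj => /=; exact: (set_mem yP).
Qed.

End WedgeSpheres.

Local Close Scope classical_set_scope.

(** * The Morse complex of a rooted tree *)

Section RootedTree.
(* The vertices of the tree are its root [None] and the nodes [Some v];
   [depth] rules out cycles of parents. *)
Variables (T : finType) (par : T -> option T) (depth : option T -> nat).
Variable e : rel (option T).
Hypothesis depthS : forall v, depth (Some v) = (depth (par v)).+1.
Hypothesis edgeP : forall x y, e x y <-> exists v,
  (x = Some v /\ y = par v) \/ (x = par v /\ y = Some v).
Local Notation K := (graph_complex e).

Definition tree_edge v : {set option T} := [set Some v; par v]%SET.
(** The edge above [v] carries two arcs: [(v, true)] goes from [v] to its
    parent and [(v, false)] comes back. *)
Definition arc_tail (a : T * bool) : option T := if a.2 then Some a.1 else par a.1.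
Definition arc_head (a : T * bool) : option T := if a.2 then par a.1 else Some a.1.
Definition arc (a : T * bool) : {set option T} * {set option T} :=
  ([set arc_tail a]%SET, tree_edge a.1).
Definition arc_conflict : rel (T * bool) := fun a b =>
  (a != b) && ((a.1 == b.1) || (arc_tail a == arc_tail b)).

Lemma par_neq v : par v <> Some v.
Proof. by move=> pv; have := depthS v; rewrite pv; lia. Qed.

Lemma tree_edgeE a : tree_edge a.1 = [set arc_tail a; arc_head a]%SET.
Proof. by case: a => v [] //=; rewrite /tree_edge finset.setUC. Qed.

Lemma tree_edge_inj : injective tree_edge.
Proof.
move=> v w vw.
have : Some v \in tree_edge w by rewrite -vw !finset.inE eqxx.
have : Some w \in tree_edge v by rewrite vw !finset.inE eqxx.
rewrite !finset.inE => /orP[/eqP[->]//|/eqP wv] /orP[/eqP[]//|/eqP vw'].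
by have := depthS w; rewrite wv -vw' depthS -wv; have := depthS v; rewrite -wv; lia.
Qed.

Lemma card_tree_edge v : #|tree_edge v| = 2%N.
Proof. by rewrite cards2 eq_sym; have /eqP/negbTE -> := @par_neq v. Qed.

Lemma arc_inj : injective arc.
Proof.
move=> [v b] [w b'] [] /finset.set1_inj tt' /tree_edge_inj vw; subst w.
case: b b' tt' => -[] //=; rewrite /arc_tail /= => h; by have := @par_neq v; rewrite h.
Qed.

Lemma tree_edge_simplex v : tree_edge v \in simplices K.
Proof.
rewrite finset.inE; apply/orP; right; apply/existsP; exists (Some v).
apply/existsP; exists (par v); rewrite eqxx andbT; apply/andP; split.
  by rewrite eq_sym; exact/eqP/par_neq.
by apply/edgeP; exists v; left.
Qed.

Lemma vertex_simplex x : [set x]%SET \in simplices K.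
Proof. by rewrite finset.inE; apply/orP; left; apply/existsP; exists x. Qed.

Lemma simplexP s : s \in simplices K ->
  (exists x, s = [set x]%SET) \/ (exists v, s = tree_edge v).
Proof.
rewrite finset.inE => /orP[/existsP[x /eqP->]|]; first by left; exists x.
case/existsP=> x /existsP[y /and3P[_ /edgeP[v xy] /eqP->]]; right; exists v.
by case: xy => -[-> ->] //; rewrite finset.setUC.
Qed.

Lemma face_arc s t : s \in simplices K -> t \in simplices K ->
  s \subset t -> #|t| = #|s|.+1 -> exists a, (s, t) = arc a.
Proof.
move=> /simplexP[[x ->]|[v ->]] /simplexP[[y ->]|[w ->]];
  rewrite ?cards1 ?card_tree_edge // finset.sub1set !finset.inE => xw _.
case/orP: xw => /eqP->; last by exists (w, false).
by exists (w, true).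
Qed.

Section Field.
Variable V : {set {set option T} * {set option T}}.

(** Along a closed path in [V], look at a vertex of maximal depth.  It is
    entered from its parent and left towards its parent, so the edge above it
    is matched twice. *)
Lemma matching_acyclic :
  (forall p, p \in V -> exists a, p = arc a) ->
  (forall a b, arc a \in V -> arc b \in V -> ~~ arc_conflict a b) ->
  ~ exists p k a b, [/\ V_path K V p k a b, k != 0%N & a k = a 0%N].
Proof.
move=> Varc Vind [p [k [a [b [[aK abV] k0 ak]]]]].
case: k => [//|k] in aK abV k0 ak.
have step i : (i < k.+1)%N -> exists c, [/\ arc c \in V, a i = [set arc_tail c]%SET &
    a i.+1 = [set arc_head c]%SET].
  move=> ik; have [bK cb abi sub neq] := abV i ik.
  have [c abc] := Varc _ abi; exists c.
  have [ai bi] : a i = [set arc_tail c]%SET /\ b i = tree_edge c.1 by case: abc.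
  split=> //; first by rewrite -abc.
  have [[_ ci] [_ ci1]] := (aK i (ltnW ik), aK i.+1 ik).
  have /cards1P[x ax] : #|a i.+1| == 1%N by rewrite ci1 -ci ai cards1.
  move: sub neq; rewrite ax ai bi tree_edgeE finset.sub1set !finset.inE.
  by case/orP => /eqP -> //; rewrite eqxx.
pose D (s : {set option T}) := \max_(x in s) depth x.
have D1 x : D [set x]%SET = depth x by rewrite /D big_set1.
pose i := [arg max_(i > ord0 : 'I_k.+1) D (a i.+1)].
have iP (j : 'I_k.+1) : (D (a j.+1) <= D (a i.+1))%N.
  by rewrite /i; case: arg_maxnP => // i' _ h; exact: h.
(* The path is closed, so position 0 is covered by position [k.+1]. *)
have maxD j : (j <= k.+1)%N -> (D (a j) <= D (a i.+1))%N.
  case: j => [_|j jk]; last exact: (iP (Ordinal jk)).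
  by rewrite -ak; exact: (iP ord_max).
have [c [cV ci ci1]] := step i (ltn_ord i).
have [c' [c'V c'i [j jk c'j]]] : exists c', [/\ arc c' \in V,
    a i.+1 = [set arc_tail c']%SET & exists2 j, (j <= k.+1)%N & a j = [set arc_head c']%SET].
  have [ik|ik] := ltnP i k.
    by have [c' [? ? ?]] := step i.+1 ik; exists c'; split=> //; exists i.+2.
  have ei : (i : nat) = k by apply/eqP; rewrite eqn_leq ik -ltnS ltn_ord.
  have [c' [? ? ?]] := step 0%N isT; exists c'; rewrite ei ak; split=> //.
  by exists 1%N.
have tc' : arc_tail c' = arc_head c by apply: finset.set1_inj; rewrite -c'i ci1.
have := maxD i (ltnW (ltn_ord i)); have := maxD j jk.
rewrite c'j ci ci1 !D1 -tc'.
have := Vind c c' cV c'V.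
case: c c' tc' {c'i c'j cV c'V ci ci1} => v [] [w []];
  rewrite /arc_tail /arc_head /arc_conflict /= /arc_tail /=.
- by move=> -> _ _; rewrite depthS ltnn.
- by move=> -> _ _; rewrite depthS ltnn.
- by case=> ->; rewrite eqxx andbT xpair_eqE eqxx.
- by move=> _ _; rewrite depthS ltnn.
Qed.

Lemma tree_gradientP : gradient_vector_field K V <->
  (forall p, p \in V -> exists a, p = arc a) /\
  (forall a b, arc a \in V -> arc b \in V -> ~~ arc_conflict a b).
Proof.
split=> [[[faceV uniqV] _]|[Varc Vind]].
- split=> [[s t] /faceV[/= sK tK st cst]|[v b] [w c] vV wV]; first exact: face_arc.
  have twice s : s \in simplices K ->
      (s == (arc (v, b)).1) || (s == (arc (v, b)).2) ->
      (s == (arc (w, c)).1) || (s == (arc (w, c)).2) -> (v, b) = (w, c).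
    move=> sK sv sw; apply: arc_inj; apply: (card_le1_eqP (uniqV s sK));
      by rewrite finset.inE ?sv ?sw ?vV ?wV.
  rewrite /arc_conflict /=; apply/negP => /andP[/eqP vw /orP[/eqP e1|/eqP e1]].
    apply: vw; apply: (twice (tree_edge v) (tree_edge_simplex v)).
      by rewrite eqxx orbT.
    by rewrite -e1 eqxx orbT.
  apply: vw; apply: (twice [set arc_tail (v, b)]%SET (vertex_simplex _)).
    by rewrite eqxx.
  by rewrite e1 eqxx.
- split; last exact: matching_acyclic.
  split=> [p /Varc[a ->]|s sK].
    split; [exact: vertex_simplex | exact: tree_edge_simplex | |].
      by rewrite /= tree_edgeE finset.sub1set !finset.inE eqxx.
    by rewrite /= cards1 card_tree_edge.
  apply/card_le1_eqP => q p; rewrite !finset.inE => /andP[qV sq] /andP[pV sp].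
  have [[a pa] [b qb]] := (Varc p pV, Varc q qV); subst p q.
  congr arc; apply/eqP; apply/negPn/negP => ab.
  have /negP[] := Vind a b pV qV; rewrite /arc_conflict ab /=.
  have cd x v : [set x]%SET <> tree_edge v.
    by move=> xv; have := card_tree_edge v; rewrite -xv cards1.
  case/orP: sp => /eqP /= sp; case/orP: sq => /eqP /= sq; move: sp; rewrite sq.
  + by move/finset.set1_inj => ->; rewrite eqxx orbT.
  + by move=> h; case: (cd _ _ (esym h)).
  + by move=> h; case: (cd _ _ h).
  + by move/tree_edge_inj => ->; rewrite eqxx.
Qed.

End Field.
(** Sending an arc to the primitive field pairing its tail with its edge
    identifies the independent sets of arcs with the gradient vector fields. *)
Lemma tree_morse (R : realType) : (T * bool)%type ->
  homotopy_equivalent R (realization R (morse_complex K))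
                        (realization R (indep_complex arc_conflict)).
Proof.
move=> a0; pose inv p := odflt a0 [pick a | arc a == p].
have arcK : cancel arc inv.
  move=> a; rewrite /inv; case: pickP => [b /eqP/arc_inj//|/(_ a)].
  by rewrite eqxx.
have morseP V : V \in simplices (morse_complex K) <-> V != finset.set0 /\
    (forall p, p \in V -> exists a, p = arc a) /\
    (forall a b, arc a \in V -> arc b \in V -> ~~ arc_conflict a b).
  rewrite finset.inE; split=> [/andP[V0 /asboolP/tree_gradientP[? ?]]//|[V0 Vg]].
  by rewrite V0; apply/asboolP/tree_gradientP.
have invK V : V \in simplices (morse_complex K) -> (arc @: (inv @: V) = V)%SET.
  move=> /morseP[_ [Varc _]]; rewrite -imset_comp -[RHS]imset_id.
  by apply: eq_in_imset => p /Varc[a ->] /=; rewrite arcK.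
have KL V : V \in simplices (morse_complex K) ->
    (inv @: V)%SET \in simplices (indep_complex arc_conflict).
  move=> /morseP[V0 [Varc Vind]]; apply/indepP; split.
    by case/set0Pn: V0 => p pV; apply/set0Pn; exists (inv p); exact: imset_f.
  move=> _ _ /imsetP[p pV ->] /imsetP[q qV ->].
  have [[a pa] [b qb]] := (Varc p pV, Varc q qV); subst p q.
  by rewrite !arcK; exact: Vind.
have LK s : s \in simplices (indep_complex arc_conflict) ->
    (arc @: s)%SET \in simplices (morse_complex K).
  move=> /indepP[s0 sI]; apply/morseP; split; last split.
  - by case/set0Pn: s0 => a sa; apply/set0Pn; exists (arc a); exact: imset_f.
  - by move=> _ /imsetP[a _ ->]; exists a.
  - by move=> a b; rewrite !(mem_imset _ _ arc_inj); exact: sI.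
have arcsK (s : {set T * bool}) : (inv @: (arc @: s) = s)%SET.
  by rewrite -imset_comp -[RHS]imset_id; apply: eq_imset => a /=; rewrite arcK.
apply: (contiguity_equivalence R KL LK) => s sK.
  by rewrite invK // finset.setUid.
by rewrite arcsK finset.setUid.
Qed.

End RootedTree.

(** * Folding the legs of the star *)

Section Star.
Variables (n m : nat).
Local Notation leg := ('I_0 + 'I_n + 'I_m)%type.
Local Notation len := (@star_leg_length 0 n m).
Local Notation node := {i : leg & 'I_(len i)}.

Definition star_parent (v : node) : option node :=
  if tagged v == 0%N :> nat then None
  else Some (Tagged (fun i => 'I_(len i))
               (Ordinal (leq_ltn_trans (leq_pred (tagged v)) (ltn_ord (tagged v))))).

Definition star_depth (x : option node) : nat :=
  if x is Some v then (tagged v).+1 else 0%N.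

Lemma node_eq (u v : node) : (u == v) = (tag u == tag v) && (tagged u == tagged v :> nat).
Proof.
apply/eqP/andP => [->//|]; case: u v => i p [j q] /= [/eqP ij /eqP pq]; subst j.
by congr (Tagged _ _); apply: val_inj.
Qed.

Lemma star_depthS v : star_depth (Some v) = (star_depth (star_parent v)).+1.
Proof. by rewrite /star_parent; case: eqP => [/= ->|] //=; case: (tagged v) => -[]. Qed.

Lemma Some_star_parent (u v : node) : (Some u == star_parent v) =
  (tag u == tag v) && ((tagged u).+1 == tagged v :> nat).
Proof.
rewrite /star_parent; case: (eqVneq (tagged v : nat) 0%N) => [->|v0].
  by rewrite andbF.
rewrite (inj_eq (@Some_inj _)) node_eq /=; congr (_ && _).
by move: v0; case: (nat_of_ord (tagged v)).
Qed.

Lemma star_adjP (x y : option node) : star_adj x y <-> exists v,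
  (x = Some v /\ y = star_parent v) \/ (x = star_parent v /\ y = Some v).
Proof.
have parent0 v : (star_parent v == None) = (tagged v == 0%N :> nat).
  by rewrite /star_parent; case: ifP.
split.
- case: x y => [u|] [v|] //=.
  + case/andP => uv /orP[] h.
      by exists v; right; split=> //; apply/eqP; rewrite Some_star_parent uv.
    by exists u; left; split=> //; apply/eqP; rewrite Some_star_parent eq_sym uv.
  + by rewrite -parent0 => /eqP u0; exists u; left; rewrite u0.
  + by rewrite -parent0 => /eqP u0; exists v; right; rewrite u0.
- move=> [v []] [-> ->]; case pv : (star_parent v) => [u|] /=.
  + have := Some_star_parent u v; rewrite pv eqxx => /esym/andP[uv ->].
    by rewrite eq_sym uv orbT.
  + by rewrite -parent0 pv.
  + have := Some_star_parent u v; rewrite pv eqxx => /esym/andP[-> ->].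
    by [].
  + by rewrite -parent0 pv.
Qed.

(** The arcs of a leg, listed from the center, are consecutive incidences
    of vertices with edges; they are numbered from 0, so that in a leg of
    length l the first one is 0 and the last one [2l - 1]. *)
Definition arc_code (a : node * bool) : leg * nat :=
  (tag a.1, (tagged a.1).*2 + a.2)%N.

(** Within a leg, consecutive arcs share a vertex or an edge in turn; arcs of
    different legs only share the center, left by the arcs numbered 0. *)
Definition code_conflict (x y : leg * nat) : bool :=
  if x.1 == y.1 then (x.2.+1 == y.2) || (y.2.+1 == x.2)
  else (x.2 == 0%N) && (y.2 == 0%N).

Lemma arc_code_bound a : ((arc_code a).2 < (len (arc_code a).1).*2)%N.
Proof. by case: a => [[i [p hp]] []] /=; rewrite -!mul2n; lia. Qed.

Lemma arc_code_inj : injective arc_code.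
Proof.
move=> [u b] [v c] [/eqP uv e]; have [bc pq] : b = c /\ tagged u = tagged v :> nat.
  move: e; move: (nat_of_ord (tagged u)) (nat_of_ord (tagged v)) => p q.
  by rewrite -!mul2n; case: b; case: c => /= e; split; lia.
by congr (_, _) => //; apply/eqP; rewrite node_eq uv pq /=.
Qed.

Lemma arc_conflictE a b : arc_conflict star_parent a b = code_conflict (arc_code a) (arc_code b).
Proof.
rewrite /arc_conflict /code_conflict -(inj_eq arc_code_inj) xpair_eqE.
case: a b => [u b] [v c]; rewrite /arc_tail /= node_eq.
have parents : (star_parent u == star_parent v) =
    if tag u == tag v then tagged u == tagged v :> nat
    else (tagged u == 0%N :> nat) && (tagged v == 0%N :> nat).
  case pu : (star_parent u) => [w|].
    have := Some_star_parent w u; rewrite pu eqxx => /esym/andP[wu /eqP w1].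
    have wv : (tag w == tag v) = (tag u == tag v) by rewrite (eqP wu).
    by rewrite Some_star_parent wv w1; case: ifP => //=; rewrite -w1.
  have u0 : tagged u == 0%N :> nat by move: pu; rewrite /star_parent; case: eqP.
  rewrite (eqP u0) eqxx /= (eq_sym 0%N) if_same /star_parent.
  by case: ifP.
have nodes : (Some u == Some v) = (tag u == tag v) && (tagged u == tagged v :> nat).
  by rewrite (inj_eq (@Some_inj _)) node_eq.
have up := Some_star_parent u v.
have down : (star_parent u == Some v) =
    (tag u == tag v) && ((tagged v).+1 == tagged u :> nat).
  by rewrite eq_sym Some_star_parent eq_sym.
case: b; case: c => /=; rewrite ?nodes ?up ?down ?parents;
  move: (nat_of_ord (tagged u)) (nat_of_ord (tagged v)) => p q;
  case: (tag u == tag v) => //=; rewrite -!mul2n; lia.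
Qed.

End Star.

Section Fold.
Variables (R : realType) (n m : nat).
Local Notation leg := ('I_0 + 'I_n + 'I_m)%type.
Local Notation len := (@star_leg_length 0 n m).
Local Notation node := {i : leg & 'I_(len i)}.
Local Notation slot := (leg * 'I_6)%type.

(** The arcs surviving the first folding: an arc is dominated by the arc two
    steps further from the center when that one is the last of its leg.  Numbers past the end of a leg are
    discarded too, so that all legs can be given six slots. *)
Definition kept (i : leg) : pred nat :=
  match i with
  | inl (inl _) => pred0
  | inl (inr _) => mem [:: 0; 2; 3]%N
  | inr _ => mem [:: 0; 1; 2; 4; 5]%N
  end.

Definition fold_end (i : leg) (p : nat) : nat := if kept i p then p else p.+2.

Definition slot_conflict : rel slot := fun x y =>
  [|| ~~ kept x.1 x.2, ~~ kept y.1 y.2 | code_conflict (x.1, x.2 : nat) (y.1, y.2 : nat)].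

Lemma code_conflict_sym : symmetric (@code_conflict n m).
Proof.
move=> x y; rewrite /code_conflict eq_sym.
by case: ifP => _; [rewrite orbC | rewrite andbC].
Qed.

Lemma slot_conflict_sym : symmetric slot_conflict.
Proof. by move=> x y; rewrite /slot_conflict code_conflict_sym orbCA. Qed.

Lemma slot_conflictN x y : ~~ slot_conflict x y =
  [&& kept x.1 x.2, kept y.1 y.2 & ~~ code_conflict (x.1, x.2 : nat) (y.1, y.2 : nat)].
Proof. by rewrite /slot_conflict !negb_or !negbK. Qed.

Lemma keptW i p : kept i p -> (p < (len i).*2)%N /\ fold_end i p = p.
Proof.
move=> ip; rewrite /fold_end ip; split=> //.
by case: i ip => [[//|i]|i]; rewrite /= !inE /=; lia.
Qed.

Lemma fold_end_kept i p : (p < (len i).*2)%N -> kept i (fold_end i p).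
Proof.
by rewrite /fold_end; case: i => [[[]//|i]|i] /=; do 6? [case: p => [|p] //].
Qed.

(** The last arc of a leg is in conflict only with the one before it, which is
    also a neighbor of the arc folded onto it. *)
Lemma fold_end_conflict i p y : (p < (len i).*2)%N -> (y.2 < (len y.1).*2)%N ->
  ~~ code_conflict (i, p) y -> ~~ code_conflict (i, fold_end i p) y.
Proof.
case: y => j q; rewrite /code_conflict /fold_end /=.
case: (i =P j) => [<-|_].
  by case: i => [[[]//|i]|i] /=; do 6? [case: p => [|p] //];
    do 6? [case: q => [|q] //].
case: ifP => // ip _ _; rewrite !negb_and => _; exact: orTb.
Qed.

Definition slot_of (a : node * bool) : slot :=
  ((arc_code a).1, inord (fold_end (arc_code a).1 (arc_code a).2)).

Lemma leg_gt0 (i : leg) p : (minn p (len i).-1 < len i)%N.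
Proof. by rewrite gtn_min; case: i => [[[]//|i]|i] /=; lia. Qed.

(** The truncation only concerns slots past the end of a leg. *)
Definition arc_at (x : slot) : node * bool :=
  (Tagged (fun i => 'I_(len i)) (Ordinal (leg_gt0 x.1 x.2./2)), odd x.2).

Lemma arc_atK (x : slot) : kept x.1 x.2 -> arc_code (arc_at x) = (x.1, x.2 : nat).
Proof.
case: x => i [p hp] /keptW[/= pi _]; congr (_, _).
transitivity ((minn p./2 (len i).-1).*2 + odd p)%N; first by [].
have -> : minn p./2 (len i).-1 = p./2.
  by apply/minn_idPl; move: pi; rewrite -mul2n; lia.
by rewrite addnC odd_double_half.
Qed.

Lemma slot_ofE a : (slot_of a).2 = fold_end (arc_code a).1 (arc_code a).2 :> nat.
Proof.
rewrite inordK //; have /fold_end_kept/keptW[] := arc_code_bound a.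
move: (arc_code a) => [i p] /=; move: (fold_end i p) => q + _.
by move=> /leq_trans; apply; case: i => [[[]|]|].
Qed.

Lemma star_fold : homotopy_equivalent R
  (realization R (indep_complex (arc_conflict (@star_parent n m))))
  (realization R (indep_complex slot_conflict)).
Proof.
have kept_of a : kept (slot_of a).1 (slot_of a).2.
  by rewrite slot_ofE; apply: fold_end_kept; exact: arc_code_bound.
have code_at_of a : arc_code (arc_at (slot_of a)) =
    ((arc_code a).1, fold_end (arc_code a).1 (arc_code a).2).
  by rewrite arc_atK // slot_ofE.
have foldl a b : ~~ code_conflict (arc_code a) (arc_code b) ->
    ~~ code_conflict (arc_code (arc_at (slot_of a))) (arc_code b).
  rewrite code_at_of; move: (arc_code_bound a) (arc_code_bound b).
  by case: (arc_code a) => i p; exact: fold_end_conflict.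
have fold2 a b : ~~ code_conflict (arc_code a) (arc_code b) ->
    ~~ code_conflict (arc_code (arc_at (slot_of a))) (arc_code (arc_at (slot_of b))).
  by move=> /foldl; rewrite ![code_conflict (arc_code (arc_at (slot_of a))) _]code_conflict_sym; exact: foldl.
apply: (indep_equivalence R (phi := slot_of) (psi := arc_at)).
- by move=> a b; rewrite !arc_conflictE code_conflict_sym.
- exact: slot_conflict_sym.
- move=> a b _ _; rewrite arc_conflictE slot_conflictN !kept_of => /fold2.
  by rewrite !code_at_of -!slot_ofE.
- move=> x y _ _; rewrite slot_conflictN arc_conflictE => /and3P[xk yk].
  by rewrite !arc_atK.
- by move=> a b _ _; rewrite !arc_conflictE; exact: foldl.
- move=> x y _ _; rewrite !slot_conflictN => /and3P[xk yk xy].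
  rewrite kept_of yk slot_ofE arc_atK //.
  by have [_ ->] := keptW xk.
Qed.

End Fold.

Section Split.
Variables (R : realType) (r m : nat).
Local Notation n := r.+1.
Local Notation leg := ('I_0 + 'I_n + 'I_m)%type.
Local Notation slot := (leg * 'I_6)%type.
Local Notation J := ('I_n + 'I_m * bool)%type.
Local Notation V := ((J * bool) + option 'I_r)%type.

(** Folding the first arc of a leg of length 3 onto its third one leaves the
    first arcs of the legs of length 2, pairwise in conflict, and isolated
    pairs of conflicting arcs, one or two for each leg. *)
Definition to_join (x : slot) : V :=
  match x.1 with
  | inl (inl _) => inr None
  | inl (inr i) => if x.2 == 0%N :> nat then inr (unlift ord0 i)
                   else inl (inl i, x.2 == 3 :> nat)
  | inr i => if (x.2 <= 2)%N then inl (inr (i, false), x.2 == 1 :> nat)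
             else inl (inr (i, true), x.2 == 5 :> nat)
  end.

Definition of_join (v : V) : slot :=
  match v with
  | inl (inl i, b) => (inl (inr i), inord (if b then 3 else 2))
  | inl (inr (i, false), b) => (inr i, inord (if b then 1 else 2))
  | inl (inr (i, true), b) => (inr i, inord (if b then 5 else 4))
  | inr p => (inl (inr (odflt ord0 (omap (lift ord0) p))), inord 0)
  end.

Lemma join_conflict_sym : symmetric (@join_conflict J r).
Proof. by move=> [a|p] [b|q] //=; rewrite ?(eq_sym a.1) ?(eq_sym a.2) // eq_sym. Qed.

Lemma to_joinK v : to_join (of_join v) = v.
Proof.
case: v => [[[i|[i []]] []]|[j|]]; rewrite /to_join /= ?inordK //=.
  by rewrite liftK.
by rewrite unlift_none.
Qed.

Lemma short_eq (i j : 'I_n) : (inl (inr i) == inl (inr j) :> leg) = (i == j).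
Proof. by []. Qed.

Lemma long_eq (i j : 'I_m) : (inr i == inr j :> leg) = (i == j).
Proof. by []. Qed.

(** The only arcs moved are the first ones of the legs of length 3. *)
Lemma of_joinK (x : slot) : kept x.1 x.2 ->
  exists2 k, of_join (to_join x) = (x.1, k) &
    k = x.2 \/ exists i, [/\ x.1 = inr i, x.2 = 0%N :> nat & k = 2%N :> nat].
Proof.
have unliftK (i : 'I_n) : odflt ord0 (omap (lift ord0) (unlift ord0 i)) = i.
  by case: unliftP.
case: x => [[[[]//|i]|i] [p hp]] ip; rewrite /to_join /=.
- exists (Ordinal hp); last by left.
  do 6? [case: p hp ip => [|p] hp ip //=]; rewrite ?unliftK;
    by congr (_, _); apply: val_inj; rewrite /= inordK.
- have [p0|p0] := eqVneq p 0%N.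
    exists (inord 2); first by rewrite p0.
    by right; exists i; rewrite inordK.
  exists (Ordinal hp); last by left.
  do 6? [case: p hp ip p0 => [|p] hp ip p0 //=];
    by congr (_, _); apply: val_inj; rewrite /= inordK.
Qed.

Lemma star_split : homotopy_equivalent R
  (realization R (indep_complex (@slot_conflict n m)))
  (realization R (join_complex J r)).
Proof.
apply: (indep_equivalence R (phi := to_join) (psi := of_join)).
- exact: slot_conflict_sym.
- exact: join_conflict_sym.
- move=> [i [p hp]] [j [q hq]] _ _; rewrite slot_conflictN /code_conflict /to_join /=.
  case: i j => [[[]//|i]|i] [[[]//|j]|j] /=; rewrite ?short_eq ?long_eq;
    do 6? [case: p hp => [|p] hp //]; do 6? [case: q hq => [|q] hq //=];
    rewrite ?andbT ?andbF //=.
  by case: (eqVneq i j) => // ->; rewrite eqxx.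
- move=> v w _ _; rewrite slot_conflictN /code_conflict.
  case: v => [[[i|[i []]] []]|p]; case: w => [[[j|[j []]] []]|q] //=;
    rewrite ?inordK //= ?short_eq ?long_eq ?andbF ?andbT ?if_same //=.
  by rewrite negbK => /eqP ->; rewrite eqxx.
- move=> x [j q] _ _; rewrite !slot_conflictN => /and3P[xk jq xq].
  have [k -> [->|[i [xi x0 k2]]]] := of_joinK xk; first by rewrite xk jq.
  move: xq; rewrite jq xi x0 k2 /code_conflict /=.
  case: eqP => [ij|_ _] //=; subst j; move: jq; rewrite /=.
  by case: q => q hq; do 6? [case: q hq => [|q] hq //=].
- by move=> v w _ _; rewrite to_joinK.
Qed.

End Split.

Theorem theorem15 (R : realType) (n m : nat) (hn : (1 <= n)%N) :
  homotopy_equivalent R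
    (realization R (morse_complex (extended_star 0 n m)))
    (wedge_spheres R (n - 1) (2 * m + n)).
Proof.
case: n hn => [//|r] _; rewrite subn1 /=.
have -> : (2 * m + r.+1)%N = #|{: 'I_r.+1 + 'I_m * bool}|.
  by rewrite card_sum card_prod !card_ord card_bool; lia.
pose a0 : {i : 'I_0 + 'I_r.+1 + 'I_m & 'I_(star_leg_length i)} :=
  Tagged (fun i => 'I_(star_leg_length i))
    (ord0 : 'I_(@star_leg_length 0 r.+1 m (inl (inr ord0)))).
apply: homotopy_equivalent_trans
  (tree_morse (@star_depthS _ _) (@star_adjP _ _) R (a0, true)) _.
apply: homotopy_equivalent_trans (star_fold R r.+1 m) _.
apply: homotopy_equivalent_trans (star_split R r m) _.
exact: join_wedge_spheres.
Qed.
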